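(* Assume all of the following. (1) $\{\alpha_t\}_{t\ge 0}$ is a decreasing sequence of positive reals with $\sum_t\alpha_t=\infty$, $\sum_t\alpha_t^2<\infty$, and $\lim_{t\to\infty}\left(\frac1{\alpha_{t+1}}-\frac1{\alpha_t}\right)<\infty$ (the limit exists and is finite). (2) The chain $\{S_t\}$ has a unique stationary distribution $\mu$, and $\mu(U)>0$ for every non-empty (relatively) open $U\subseteq\mathcal S$. (3) $\sup_{s\in\mathcal S}\|x(s)\|<\infty$ and $\sup_{s\in\mathcal S}|r(s)|<\infty$. (4) For every measurable $f:\mathcal S\to\mathbb R^n$ with $f=0$ $\mu$-a.e., also $P_\pi f=0$ $\mu$-a.e. (5) (Poisson equation) For each $w\in\mathbb R^d$ there is a measurable function $\nu_w:\mathcal Y\to\mathbb R^d$ with $\nu_w(y)-(P_{\mathcal Y}\nu_w)(y)=H(w,y)-h(w)$ for all $w\in\mathbb{R}^d,y\in\mathcal{Y}$, and there is a constant $C$ such that for all $w,w'\in\mathbb R^d$, $y\in\mathcal Y$: $\|\nu_w(y)\|\le C(1+\|w\|)(1+\|y\|)$ and $\|(P_{\mathcal Y}\nu_w)(y)-(P_{\mathcal Y}\nu_{w'})(y)\|\le C\|w-w'\|(1+\|y\|)$. (6) (Law of iterated logarithm) For each $w\in\mathbb R^d$ there is an almost surely finite random variable $\zeta$ such that almost surely $\left\|\sum_{t=1}^n\left(H(w,Y_t)-h(w)\right)\right\|\le\zeta\sqrt{n\log\log n}$ for all $n\ge 3$. (7) $\mathcal S$ is compact. Let $w_*\in\mathcal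 W_*$. Then for any $w_0\in\mathbb R^d$ there exists $\mathcal S^+\subseteq\mathcal S$ with $\mu(\mathcal S^+)=1$ such that the linear TD iterates $\{w_t\}$ started from $w_0$ satisfy, for all $s\in\mathcal S^+$, $$\lim_{t\to\infty}x(s)^\top w_t=x(s)^\top w_*\quad\text{almost surely}.$$
   Context: Setting: $K,d\in\mathbb N$; $\mathcal S\subseteq\mathbb R^K$ with its Borel $\sigma$-algebra; $p(\cdot\mid s)$ is a Markov transition kernel on $\mathcal S$; $\{S_t\}_{t\ge0}$ is a Markov chain with kernel $p$ and arbitrary initial distribution; $r:\mathcal S\to\mathbb R$ is a measurable reward function; $\gamma\in[0,1)$; $x:\mathcal S\to\mathbb R^d$ is a measurable feature map (no linear independence is assumed). $\|\cdot\|$ is the Euclidean norm. $(P_\pi f)(s)=\int_{\mathcal S}f(s')\,p(ds'\mid s)$. A stationary distribution is a probability measure $\mu$ on $\mathcal S$ with $\mu(Z)=\int_{\mathcal S}p(Z\mid s)\mu(ds)$ for all Borel $Z$. Linear TD: with $R_{t+1}=r(S_t)$, $$w_{t+1}=w_t+\alpha_t\left(R_{t+1}+\gamma x(S_{t+1})^\top w_t-x(S_t)^\top w_t\right)x(S_t).$$ $A=\int_{\mathcal S}x(s)\left(\gamma(P_\pi x)(s)^\top-x(s)^\top\right)\mu(ds)\in\mathbb R^{d\times d}$, $b=\int_{\mathcal S}x(s)r(s)\mu(ds)\in\mathbb R^d$, $\mathcal W_*=\{w\in\mathbb R^d: Aw+b=0\}$ (the set of TD fixed points). Pair chain: $Y_t=(S_t,S_{t+1})$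 is a Markov chain evolving in a measurable set $\mathcal Y\subseteq\mathcal S\times\mathcal S\subset\mathbb R^{2K}$, with transition kernel $P_{\mathcal Y}$ (from $(s,s')$ it moves to $(s',s'')$ with $s''\sim p(\cdot\mid s')$) and unique stationary distribution $\eta(ds,ds')=\mu(ds)p(ds'\mid s)$; $(P_{\mathcal Y}f)(y)=\int_{\mathcal Y}f(y')P_{\mathcal Y}(dy'\mid y)$. For $y=(s,s')$, $H(w,y)=\left(r(s)+\gamma w^\top x(s')-w^\top x(s)\right)x(s)$ and $h(w)=\mathbb E_{y\sim\eta}[H(w,y)]=Aw+b$. *)

(* Defs.v *)
From HB Require Import structures.
From mathcomp Require Import all_boot all_order all_algebra.
From mathcomp Require Import all_classical all_reals all_analysis.
From mathcomp Require Import measurable_realfun.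

Set Implicit Arguments.
Unset Strict Implicit.
Unset Printing Implicit Defensive.
Import Order.TTheory GRing.Theory Num.Theory.
Import numFieldNormedType.Exports.

Local Open Scope classical_set_scope.
Local Open Scope ring_scope.

Definition borel (T : ptopologicalType) := g_sigma_algebraType (@open T).
HB.instance Definition _ (T : ptopologicalType) := Measurable.on (borel T).

(* The library's measurable types are pointed, hence the non-emptiness proof;
   a state space carrying a Markov chain is non-empty anyway. The topology is
   the relative one, so [borel (state S0)] is S with its Borel sigma-algebra. *)
Definition state (R : realType) (K : nat) (S : set 'rV[R]_K)
  (S0 : S !=set0) : Type := set_type S.

Section state_instances.
Context (R : realType) (K : nat) (S : set 'rV[R]_K) (S0 : S !=set0).

HB.instance Definition _ := Topological.copy (state S0) (set_type S).

Let point_in : projT1 (cid S0) \in S.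
Proof. by rewrite inE; exact: (projT2 (cid S0)). Qed.

HB.instance Definition _ := isPointed.Build (state S0)
  (exist _ (projT1 (cid S0)) point_in : set_type S).

End state_instances.

(* The library norm on matrices is the max norm; this is the Euclidean one, for
   row and column vectors alike. *)
Definition enorm (R : realType) (m n : nat) (v : 'M[R]_(m, n)) : R :=
  Num.sqrt (\sum_i \sum_j v i j ^+ 2).

Definition dotp (R : realType) (d : nat) (u v : 'cV[R]_d) : R :=
  \sum_i u i 0 * v i 0.

(* Entrywise; an entry that is not integrable has an unspecified real value. *)
Definition mx_integral (R : realType) (dX : measure_display)
  (X : measurableType dX) (m n : nat) (mu : {measure set X -> \bar R})
  (D : set X) (f : X -> 'M[R]_(m, n)) : 'M[R]_(m, n) :=
  \matrix_(i, j) \int[mu]_(z in D) f z i j.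

(* D is the state space of the kernel; measures on D are represented by measures
   on X giving mass one to D. *)
Definition stationary_dist (R : realType) (dX : measure_display)
  (X : measurableType dX) (D : set X) (k : X -> {measure set X -> \bar R})
  (m : probability X R) : Prop :=
  m D = 1%E /\
  forall Z : set X, measurable Z -> Z `<=` D ->
    m Z = (\int[m]_(z in D) k z Z)%E.

Definition unique_stationary_dist (R : realType) (dX : measure_display)
  (X : measurableType dX) (D : set X) (k : X -> {measure set X -> \bar R})
  (m : probability X R) : Prop :=
  stationary_dist D k m /\
  forall m' : probability X R, stationary_dist D k m' ->
    forall Z : set X, measurable Z -> m' Z = m Z.

(* Markov property with respect to the natural filtration. *)
Definition markov_chain (R : realType) (dO dX : measure_display)
  (Omega : measurableType dO) (X : measurableType dX) (P : probability Omega R)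
  (p : R.-pker X ~> X) (S_ : nat -> {RV P >-> X}) : Prop :=
  forall (t : nat) (A : set Omega) (B : set X),
    g_sigma_preimage (fun i : 'I_t.+1 => S_ i : Omega -> X) A ->
    measurable B ->
    P (A `&` S_ t.+1 @^-1` B) = (\int[P]_(om in A) p (S_ t om) B)%E.

Section pair_chain.
Context (R : realType) (dX : measure_display) (X : measurableType dX).
Variable p : R.-pker X ~> X.

Let measurable_pair_fst (a : X) :
  measurable_fun [set: X] (fun b : X => (a, b)).
Proof. by apply: measurable_fun_pair => //; exact: measurable_cst. Qed.

Definition pair_kernel (y : X * X) : set (X * X) -> \bar R :=
  pushforward (p y.2) (fun b : X => (y.2, b)).

Let pair_kernel0 (y : X * X) : pair_kernel y set0 = 0%E.
Proof. by rewrite /pair_kernel /pushforward preimage_set0 measure0. Qed.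

Let pair_kernel_ge0 (y : X * X) (A : set (X * X)) : (0 <= pair_kernel y A)%E.
Proof. exact: measure_ge0. Qed.

Let pair_kernel_sigma_additive (y : X * X) :
  semi_sigma_additive (pair_kernel y).
Proof.
move=> F mF tF mUF; rewrite /pair_kernel /pushforward preimage_bigcup.
have mpre n : measurable ((fun b : X => (y.2, b)) @^-1` F n).
  by rewrite -[X in measurable X]setTI; exact: measurable_pair_fst.
apply: measure_semi_sigma_additive => //.
- apply/trivIsetP => /= i j _ _ ij; rewrite -preimage_setI.
  by move/trivIsetP : tF => /(_ _ _ _ _ ij) ->//; rewrite preimage_set0.
- exact: bigcup_measurable.
Qed.

HB.instance Definition _ (y : X * X) := isMeasure.Build _ _ _ (pair_kernel y)
  (pair_kernel0 y) (pair_kernel_ge0 y) (@pair_kernel_sigma_additive y).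

(* eta(ds, ds') = mu(ds) p(ds' | s) *)
Definition pair_law (mu : probability X R) (eta : probability (X * X)%type R)
  : Prop :=
  forall Z : set (X * X), measurable Z ->
    eta Z = (\int[mu]_s p s (xsection Z s))%E.

End pair_chain.

Section linear_td.
Context (R : realType) (dX : measure_display) (X : measurableType dX) (d : nat).
Variables (p : R.-pker X ~> X) (mu : probability X R) (gamma : R).
Variables (r : X -> R) (x : X -> 'cV[R]_d).

Definition Ppi (n : nat) (f : X -> 'cV[R]_n) (s : X) : 'cV[R]_n :=
  mx_integral (p s) setT f.

Definition td_A : 'M[R]_d :=
  mx_integral mu setT (fun s => x s *m (gamma *: (Ppi x s)^T - (x s)^T)).

Definition td_b : 'cV[R]_d := mx_integral mu setT (fun s => r s *: x s).

Definition td_fixed_points : set 'cV[R]_d :=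
  [set w | td_A *m w + td_b = 0].

Definition td_H (w : 'cV[R]_d) (y : X * X) : 'cV[R]_d :=
  (r y.1 + gamma * dotp w (x y.2) - dotp w (x y.1)) *: x y.1.

Definition td_h (Y : set (X * X)) (eta : probability (X * X)%type R)
  (w : 'cV[R]_d) : 'cV[R]_d :=
  mx_integral eta Y (td_H w).

Fixpoint td_iter (alpha : nat -> R) (w0 : 'cV[R]_d) (traj : nat -> X)
  (t : nat) : 'cV[R]_d :=
  if t is t'.+1 then
    let w := td_iter alpha w0 traj t' in
    w + alpha t' *: ((r (traj t') + gamma * dotp (x (traj t'.+1)) w
                        - dotp (x (traj t')) w) *: x (traj t'))
  else w0.

End linear_td.

(* The last clause says that the limit exists in R, i.e. is finite. *)
Definition step_sizes (R : realType) (alpha : nat -> R) : Prop :=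
  [/\ forall t, 0 < alpha t,
      nonincreasing_seq alpha,
      series alpha @ \oo --> +oo,
      cvgn (series (fun t => alpha t ^+ 2)) &
      cvgn (fun t => (alpha t.+1)^-1 - (alpha t)^-1)].

(* Y is the set in which the pair chain evolves; the norm of a pair is its
   Euclidean norm in R^(2K). *)
Definition poisson_equation (R : realType) (K d : nat) (S : set 'rV[R]_K)
  (S0 : S !=set0) (p : R.-pker borel (state S0) ~> borel (state S0))
  (Y : set (borel (state S0) * borel (state S0)))
  (H : 'cV[R]_d -> borel (state S0) * borel (state S0) -> 'cV[R]_d)
  (h : 'cV[R]_d -> 'cV[R]_d) : Prop :=
  let PY (f : borel (state S0) * borel (state S0) -> 'cV[R]_d) y :=
    mx_integral (pair_kernel p y) Y f in
  let normY (y : borel (state S0) * borel (state S0)) :=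
    enorm (row_mx (set_val (y.1 : set_type S)) (set_val (y.2 : set_type S))) in
  exists nu : 'cV[R]_d -> borel (state S0) * borel (state S0) -> 'cV[R]_d,
    [/\ forall w, measurable_fun Y (nu w : _ -> borel 'cV[R]_d),
        forall w y, Y y -> nu w y - PY (nu w) y = H w y - h w &
        exists C : R, forall w w' y, Y y ->
          enorm (nu w y) <= C * (1 + enorm w) * (1 + normY y) /\
          enorm (PY (nu w) y - PY (nu w') y)
            <= C * enorm (w - w') * (1 + normY y)].

Definition iterated_log_bound (R : realType) (dO dX : measure_display)
  (Omega : measurableType dO) (X : measurableType dX) (d : nat)
  (P : probability Omega R) (Y_ : nat -> Omega -> X)
  (H : 'cV[R]_d -> X -> 'cV[R]_d) (h : 'cV[R]_d -> 'cV[R]_d) : Prop :=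
  forall w : 'cV[R]_d, exists zeta : {RV P >-> \bar R},
    {ae P, forall om, zeta om \is a fin_num} /\
    {ae P, forall om, forall n : nat, (3 <= n)%N ->
      ((enorm (\sum_(1 <= t < n.+1) (H w (Y_ t om) - h w)))%:E
        <= zeta om * (Num.sqrt (n%:R * ln (ln n%:R)))%:E)%E}.

(* Main.v *)
Require Import Defs.
From HB Require Import structures.
From mathcomp Require Import all_boot all_order all_algebra.
From mathcomp Require Import all_classical all_reals all_analysis.
From mathcomp Require Import measurable_realfun ring lra.

Set Implicit Arguments.
Unset Strict Implicit.
Unset Printing Implicit Defensive.
Import Order.TTheory GRing.Theory Num.Theory.
Import numFieldNormedType.Exports.

Local Open Scope classical_set_scope.
Local Open Scope ring_scope.

(* Put z = (w - w_*, 1), so that TD becomes the homogeneous linear iteration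
   z_{t+1} = z_t + alpha_t B(Y_t) z_t. The Poisson solutions for w_* and for the
   w_* + e_j assemble, by affinity of H in w, into a bounded matrix function N
   with B(Y_t) = A + N(Y_t) - M(S_{t+1}), where M(s) is the mean of N(s, .)
   under p(. | s).
   The expectation of |z|^2 + 2 alpha z^T M z decreases up to summable errors, by
   v^T A v <= - c |L v|^2 with L the feature covariance; hence sup_t E |z_t|^2 is
   finite and sum_t alpha_t E |L z_t|^2 converges. Consequently
   z_t = z_0 + sum_{s<t} alpha_s A z_s + (a.s. convergent sequence), the noise
   being an L^2-bounded martingale plus absolutely summable and vanishing terms.
   Stationarity gives ker L <= ker A, that is A = G L, so L z_t varies by at most
   C alpha_t |L z_t| up to a convergent sequence; as sum_t alpha_t is infinite
   and sum_t alpha_t |L z_t|^2 is finite, L z_t -> 0. Finally x(s) belongs to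
   the row space of L for mu-almost every s, no matter how degenerate L is. *)

(** * Bounded measurable functions and disintegration *)

(** The noise is multiplicative, so its size is controlled only once z_t is, while the drift A is
    dissipative only through L: along ker L nothing pulls z_t back. Hence no almost sure bound on
    z_t is attempted. A uniform bound on E |z_t|^2 makes sum_t a_t (1 + |z_t|^2) almost surely
    finite for every nonnegative summable sequence a, and this replaces boundedness of the paths
    wherever the noise is handled. The correction 2 alpha z^T M z comes from the cross term of
    |z_{t+1}|^2, which contains z^T N(Y_t) z, of conditional mean z^T M(S_t) z, minus z^T M(S_{t+1})
    z. Summed over t these contributions telescope up to errors weighted by alpha_t^2 or by alpha_t
    - alpha_{t+1}, both summable. The additional coordinate 1 carries the noise H(wstar, Y_t) that
    does not vanish at wstar. As wstar is a fixed point, the mean drift has no such component, so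
    both A and L are extended by zero. *)

Section bounded_measurable.
Context (R : realType) (d : measure_display) (T : measurableType d).
Implicit Types f g : T -> R.

(** The start is deterministic and the random matrices are bounded, so every quantity at a fixed
    time is bounded, by a constant depending on that time. This class is stable under sums and
    products and makes all integrals finite. *)
Definition bmeas f := measurable_fun [set: T] f /\ exists C, forall t, `|f t| <= C.

Lemma bmeas_cst c : bmeas (cst c).
Proof. by split; [exact: measurable_cst|exists `|c|]. Qed.

Lemma bmeasD f g : bmeas f -> bmeas g -> bmeas (fun t => f t + g t).
Proof.
move=> [mf [C fC]] [mg [D gD]]; split; first exact: measurable_funD.
by exists (C + D) => t; rewrite (le_trans (ler_normD _ _))// lerD.
Qed.

Lemma bmeasM f g : bmeas f -> bmeas g -> bmeas (fun t => f t * g t).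
Proof.
move=> [mf [C fC]] [mg [D gD]]; split; first exact: measurable_funM.
by exists (C * D) => t; rewrite normrM ler_pM.
Qed.

Lemma bmeasN f : bmeas f -> bmeas (fun t => - f t).
Proof.
move=> [mf [C fC]]; split; first exact: measurable_funN.
by exists C => t; rewrite normrN.
Qed.

Lemma bmeasB f g : bmeas f -> bmeas g -> bmeas (fun t => f t - g t).
Proof. by move=> bf bg; apply: bmeasD => //; exact: bmeasN. Qed.

Lemma bmeasX f n : bmeas f -> bmeas (fun t => f t ^+ n).
Proof.
move=> bf; elim: n => [|n ih]; first exact: bmeas_cst.
by rewrite [X in bmeas X](_ : _ = fun t => f t * f t ^+ n);
  [exact: bmeasM|apply/funext => t; rewrite exprS].
Qed.

Lemma bmeas_norm f : bmeas f -> bmeas (fun t => `|f t|).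
Proof.
move=> [mf [C fC]]; split; first exact: measurableT_comp.
by exists C => t; rewrite normr_id.
Qed.

Lemma bmeas_sum (I : Type) (s : seq I) (F : I -> T -> R) :
  (forall i, bmeas (F i)) -> bmeas (fun t => \sum_(i <- s) F i t).
Proof.
move=> bF; elim: s => [|i s ih].
  by rewrite [X in bmeas X](_ : _ = cst 0);
    [exact: bmeas_cst|apply/funext => t; rewrite big_nil].
by rewrite [X in bmeas X](_ : _ = fun t => F i t + \sum_(j <- s) F j t);
  [exact: bmeasD|apply/funext => t; rewrite big_cons].
Qed.

End bounded_measurable.

Lemma bmeas_comp (R : realType) d d' (T : measurableType d)
    (T' : measurableType d') (h : T' -> T) (f : T -> R) :
  measurable_fun [set: T'] h -> bmeas f -> bmeas (f \o h).
Proof.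
move=> mh [mf [C fC]]; split; first exact: measurableT_comp.
by exists C => t; exact: fC.
Qed.

Section bounded_integral.
Context (R : realType) (d : measure_display) (T : measurableType d).
Variable P : {measure set T -> \bar R}.
Hypothesis P1 : P setT = 1%E.
Implicit Types f g : T -> R.

Lemma bmeas_integrable f : bmeas f -> P.-integrable setT (EFin \o f).
Proof.
move=> [mf [C fC]]; apply: measurable_bounded_integrable => //.
  by rewrite P1 ltry.
by exists C; split; [exact: num_real|by move=> x Cx t _ /=; rewrite (le_trans (fC t))// ltW].
Qed.

Lemma EFin_Rintegral f : bmeas f ->
  (\int[P]_t f t)%:E = (\int[P]_t (f t)%:E)%E.
Proof.
by move=> bf; rewrite /Rintegral fineK//; apply: integrable_fin_num => //;
  exact: bmeas_integrable.
Qed.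

Lemma bintegralD f g : bmeas f -> bmeas g ->
  \int[P]_t (f t + g t) = \int[P]_t f t + \int[P]_t g t.
Proof. by move=> bf bg; rewrite RintegralD//; exact: bmeas_integrable. Qed.

Lemma bintegralB f g : bmeas f -> bmeas g ->
  \int[P]_t (f t - g t) = \int[P]_t f t - \int[P]_t g t.
Proof. by move=> bf bg; rewrite RintegralB//; exact: bmeas_integrable. Qed.

Lemma bintegralZ f c : bmeas f -> \int[P]_t (c * f t) = c * \int[P]_t f t.
Proof. by move=> bf; rewrite RintegralZl//; exact: bmeas_integrable. Qed.

Lemma bintegral_cst c : \int[P]_t c = c.
Proof.
by rewrite Rintegral_cst// P1 mulr1.
Qed.

Lemma ler_bintegral f g : bmeas f -> bmeas g -> (forall t, f t <= g t) ->
  \int[P]_t f t <= \int[P]_t g t.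
Proof.
by move=> bf bg fg; apply: le_Rintegral => //; exact: bmeas_integrable.
Qed.

Lemma bintegral_sum (I : Type) (s : seq I) (F : I -> T -> R) :
  (forall i, bmeas (F i)) ->
  \int[P]_t (\sum_(i <- s) F i t) = \sum_(i <- s) \int[P]_t F i t.
Proof.
move=> bF; elim: s => [|i s ih].
  rewrite big_nil -[RHS](bintegral_cst 0).
  by apply: eq_Rintegral => t _; rewrite big_nil.
rewrite big_cons -ih -bintegralD//; last exact: bmeas_sum.
by apply: eq_Rintegral => t _; rewrite big_cons.
Qed.

Lemma bintegral_normr f C : bmeas f -> (forall t, `|f t| <= C) ->
  `|\int[P]_t f t| <= C.
Proof.
move=> bf fC; rewrite (le_trans (le_normr_Rintegral _ (bmeas_integrable bf)))//.
rewrite -[leRHS](bintegral_cst C); apply: ler_bintegral => //.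
- exact: bmeas_norm.
- exact: bmeas_cst.
Qed.

(** Jensen for the square: the variance around [m] is nonnegative. *)
Lemma sqr_bintegral f : bmeas f ->
  (\int[P]_t f t) ^+ 2 <= \int[P]_t (f t ^+ 2).
Proof.
move=> bf; set m := \int[P]_t f t.
have : 0 <= \int[P]_t ((f t - m) ^+ 2).
  by apply: Rintegral_ge0 => t _; exact: sqr_ge0.
rewrite (_ : Rintegral _ _ _ = \int[P]_t (f t ^+ 2 - (2 * m) * f t + m ^+ 2)).
  have b1 := bmeasX 2 bf; have b2 := bmeasM (bmeas_cst T (2 * m)) bf.
  have b3 := bmeas_cst T (m ^+ 2); have b4 := bmeasB b1 b2.
  rewrite bintegralD// bintegralB// bintegralZ// bintegral_cst -/m.
  by rewrite -mulrA -expr2 mulr2n mulrDl mul1r opprD addrA subrK subr_ge0.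
apply: eq_Rintegral => t _; rewrite sqrrB -mulr_natl -!mulrA; congr (_ - _ + _).
by rewrite (mulrC (f t)).
Qed.

Lemma bintegral0_ae f : bmeas f -> (forall t, 0 <= f t) ->
  \int[P]_t f t = 0 -> {ae P, forall t, f t = 0}.
Proof.
move=> bf f0 If; have : (\int[P]_t `|(f t)%:E| = 0)%E.
  under eq_integral do rewrite gee0_abs ?lee_fin//.
  by rewrite -EFin_Rintegral// If.
move/(ae_eq_integral_abs P measurableT).
have mf : measurable_fun setT (fun t => (f t)%:E).
  by apply/measurable_EFinP; case: bf.
move=> /(_ mf); apply: filterS => t /(_ Logic.I) /=.
by move=> [].
Qed.

End bounded_integral.

Section pull_kernel.
Context (R : realType) (d1 d2 d3 : measure_display).
Context (T : measurableType d1) (X : measurableType d2) (X' : measurableType d3).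
Variables (p : R.-pker X ~> X') (g : T -> X).

(** Meant for [T] the sample space carrying only the sigma-algebra of the past and [g] the current
    state: conditioning on the whole past then becomes a kernel with source [T]. *)
Definition kpull (mg : measurable_fun [set: T] g) (t : T) :
  {measure set X' -> \bar R} := p (g t).

Hypothesis mg : measurable_fun [set: T] g.

Let measurable_kpull B : measurable B -> measurable_fun [set: T] (kpull mg ^~ B).
Proof. by move=> mB; exact: measurableT_comp (measurable_kernel p _ mB) mg. Qed.

HB.instance Definition _ := isKernel.Build _ _ _ _ _ (kpull mg) measurable_kpull.

Let kpull_prob t : kpull mg t setT = 1%E.
Proof. exact: prob_kernel. Qed.

HB.instance Definition _ := Kernel_isProbability.Build _ _ _ _ _
  (kpull mg) kpull_prob.

End pull_kernel.

Section graph_kernel.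
Context (R : realType) (d1 d2 : measure_display).
Context (T : measurableType d1) (X : measurableType d2) (k : R.-pker T ~> X).

Let mpair (t : T) : measurable_fun [set: X] (fun b : X => (t, b)).
Proof. by apply: measurable_fun_pair => //; exact: measurable_cst. Qed.

(** The law of (t, b) with b drawn from [k t]. The idle [unit] component gives the shape that
    [kcomp] expects of its second kernel when the first one starts from a point. *)
Definition kgraph (t : unit * T) : set (T * X) -> \bar R :=
  pushforward (k t.2) (fun b : X => (t.2, b)).

Let kgraph0 t : kgraph t set0 = 0%E.
Proof. by rewrite /kgraph /pushforward preimage_set0 measure0. Qed.

Let kgraph_ge0 t A : (0 <= kgraph t A)%E.
Proof. exact: measure_ge0. Qed.

Let kgraph_sigma_additive t : semi_sigma_additive (kgraph t).
Proof.
move=> F mF tF mUF; rewrite /kgraph /pushforward preimage_bigcup.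
have mpre n : measurable ((fun b : X => (t.2, b)) @^-1` F n).
  by rewrite -[X in measurable X]setTI; exact: mpair.
apply: measure_semi_sigma_additive => //.
- apply/trivIsetP => /= i j _ _ ij; rewrite -preimage_setI.
  by move/trivIsetP : tF => /(_ _ _ _ _ ij) ->//; rewrite preimage_set0.
- exact: bigcup_measurable.
Qed.

HB.instance Definition _ t := isMeasure.Build _ _ _ (kgraph t)
  (kgraph0 t) (kgraph_ge0 t) (@kgraph_sigma_additive t).

Definition mkgraph : unit * T -> {measure set (T * X) -> \bar R} := kgraph.

Let measurable_kgraph A : measurable A ->
  measurable_fun [set: unit * T] (mkgraph ^~ A).
Proof.
move=> mA.
rewrite [X in measurable_fun _ X](_ : _ = (fun t => k t (xsection A t)) \o snd).
  apply: measurableT_comp => //.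
  by apply: measurable_fun_xsection_finite_kernel; rewrite inE.
by apply/funext => -[u t]; rewrite /mkgraph/= /kgraph /pushforward/= xsectionE.
Qed.

HB.instance Definition _ := isKernel.Build _ _ _ _ _ mkgraph measurable_kgraph.

Let mkgraph_prob t : mkgraph t setT = 1%E.
Proof. by rewrite /mkgraph/= /kgraph /pushforward preimage_setT; exact: prob_kernel. Qed.

HB.instance Definition _ := Kernel_isProbability.Build _ _ _ _ _
  mkgraph mkgraph_prob.

End graph_kernel.

Section disintegration.
Context (R : realType) (d1 d2 : measure_display).
Context (T : measurableType d1) (X : measurableType d2) (k : R.-pker T ~> X).
Variables (m : probability T R) (q : {measure set (T * X) -> \bar R}).
Hypothesis qE : forall A B, measurable A -> measurable B ->
  q (A `*` B) = (\int[m]_(t in A) k t B)%E.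

Let km : unit -> {measure set T -> \bar R} := fun=> m.

Let measurable_km B : measurable B -> measurable_fun [set: unit] (km ^~ B).
Proof. by move=> mB; exact: measurable_cst. Qed.

HB.instance Definition _ := isKernel.Build _ _ _ _ _ km measurable_km.

Let km_prob t : km t setT = 1%E.
Proof. exact: probability_setT. Qed.

HB.instance Definition _ := Kernel_isProbability.Build _ _ _ _ _ km km_prob.

(** Both sides are finite measures that agree on rectangles, a pi-system generating the product
    sigma-algebra. *)
Let q_kcomp A : measurable A -> q A = kcomp km (mkgraph k) tt A.
Proof.
move=> mA; apply: (@measure_unique _ _ _ [set A `*` B | A in measurable & B in measurable]
  (fun=> setT) _ _ _ _ q (mkcomp km (mkgraph k) tt)) => //.
- exact: measurable_prod_measurableType.
- move=> _ _ [A1 mA1 [B1 mB1 <-]] [A2 mA2 [B2 mB2 <-]].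
  exists (A1 `&` A2); first exact: measurableI.
  by exists (B1 `&` B2); [exact: measurableI|rewrite setXI].
- by move=> n; exists setT => //; exists setT => //; rewrite setXTT.
- by rewrite bigcup_const.
- move=> _ [A1 mA1 [B1 mB1 <-]]; rewrite qE// /mkcomp/= /kcomp.
  rewrite [LHS]integral_mkcond; apply: eq_integral => t _.
  rewrite /mkgraph /= /kgraph /pushforward /= patchE.
  case: ifPn => [|] tA.
    congr (k t _); apply/seteqP; split=> b //=; last by case.
    by move=> ?; split => //; exact/set_mem.
  rewrite [X in k t X](_ : _ = set0) ?measure0//.
  by apply/seteqP; split=> b //= -[/mem_set]; rewrite (negbTE tA).
- move=> n; rewrite -[setT]setXTT qE//.
  under eq_integral do rewrite prob_kernel.
  by rewrite integral_cst// mul1e (le_lt_trans (probability_le1 m measurableT))// ltry.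
Qed.

Lemma ge0_disintegration (F : T * X -> \bar R) : (forall y, 0 <= F y)%E ->
  measurable_fun setT F ->
  (\int[q]_y F y = \int[m]_t \int[k t]_b F (t, b))%E.
Proof.
move=> F0 mF.
rewrite (eq_measure_integral (mkcomp km (mkgraph k) tt)); last first.
  by move=> A mA _; exact: q_kcomp.
rewrite (integral_kcomp km (mkgraph k) tt F0 mF).
apply: eq_integral => t _; rewrite ge0_integral_pushforward//.
by apply: measurable_fun_pair => //; exact: measurable_cst.
Qed.

End disintegration.

Section bounded_disintegration.
Context (R : realType) (d1 d2 : measure_display).
Context (T : measurableType d1) (X : measurableType d2) (k : R.-pker T ~> X).

Lemma bmeas_section (F : T * X -> R) t : bmeas F -> bmeas (fun b => F (t, b)).
Proof.
by apply: bmeas_comp; apply: measurable_fun_pair => //; exact: measurable_cst.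
Qed.

Lemma bmeas_kernel_integral (F : T * X -> R) :
  bmeas F -> bmeas (fun t => \int[k t]_b F (t, b)).
Proof.
move=> bF; have [mF [C FC]] := bF.
(* Shifting by the bound [C] makes the integrand nonnegative, so that its kernel integral is
   measurable with values in the extended reals; the shift is subtracted at the end. *)
have bFC : bmeas (fun y => F y + C) by exact: bmeasD bF (bmeas_cst _ _).
have FC0 y : (0 <= (F y + C)%:E)%E.
  by rewrite lee_fin -lerBlDr sub0r; have := FC y; rewrite ler_norml => /andP[].
split; last first.
  exists C => t; apply: bintegral_normr => //; first exact: prob_kernel.
  exact: bmeas_section.
have -> : (fun t => \int[k t]_b F (t, b)) =
    (fun t => fine (\int[k t]_b (F (t, b) + C)%:E)%E - C).
  apply/funext => t.
  rewrite -[fine _]/(\int[k t]_b (F (t, b) + C)).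
  rewrite bintegralD ?bintegral_cst ?addrK//; try exact: prob_kernel.
  - exact: bmeas_section.
  - exact: bmeas_cst.
apply: measurable_funB; last exact: measurable_cst.
apply: measurableT_comp => //.
apply: (measurable_fun_integral_finite_kernel (fun y => (F y + C)%:E) k) => //.
by apply/measurable_EFinP; case: bFC.
Qed.

Context (dO : measure_display) (Omega : measurableType dO) (P : probability Omega R).
Variables (U : Omega -> T) (V : Omega -> X).
Hypotheses (mU : measurable_fun setT U) (mV : measurable_fun setT V).
Hypothesis UV : forall A B, measurable A -> measurable B ->
  P (U @^-1` A `&` V @^-1` B) = (\int[P]_(om in U @^-1` A) k (U om) B)%E.

HB.instance Definition _ := isMeasurableFun.Build _ _ _ _ U mU.

Let UV_ om := (U om, V om).

Let mUV : measurable_fun setT UV_.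
Proof. exact: measurable_fun_pair. Qed.

HB.instance Definition _ := isMeasurableFun.Build _ _ _ _ UV_ mUV.

(** By [UV], the joint law of [U] and [V] satisfies on rectangles the disintegration into the law of
    [U] followed by [k], hence it does so for all nonnegative integrands. *)
Let ge0_freezing (F : T * X -> R) : (forall y, 0 <= F y) -> bmeas F ->
  \int[P]_om F (U om, V om) = \int[P]_om \int[k (U om)]_b F (U om, b).
Proof.
move=> F0 bF.
have bI := bmeas_kernel_integral bF.
have P1 := probability_setT P.
have b1 : bmeas (fun om => F (U om, V om)) := bmeas_comp mUV bF.
have b2 : bmeas (fun om => \int[k (U om)]_b F (U om, b)) := bmeas_comp mU bI.
apply: EFin_inj; rewrite !EFin_Rintegral//.
have mF : measurable_fun setT (EFin \o F) by apply/measurable_EFinP; case: bF.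
have F0' y : (0 <= (EFin \o F) y)%E by rewrite lee_fin.
transitivity (\int[pushforward P UV_]_y (EFin \o F) y)%E.
  by rewrite ge0_integral_pushforward// preimage_setT.
rewrite (@ge0_disintegration _ _ _ _ _ k (distribution P U))//; last first.
  move=> A B mA mB; rewrite /distribution ge0_integral_pushforward//.
  - by rewrite -UV.
  - exact: measurable_funTS (measurable_kernel k _ mB).
rewrite ge0_integral_pushforward//; last 2 first.
- exact: measurable_fun_integral_finite_kernel.
- by move=> t _; exact: integral_ge0.
rewrite preimage_setT; apply: eq_integral => om _ /=.
rewrite EFin_Rintegral//; first exact: prob_kernel.
exact: bmeas_section.
Qed.

Lemma freezing (F : T * X -> R) : bmeas F ->
  \int[P]_om F (U om, V om) = \int[P]_om \int[k (U om)]_b F (U om, b).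
Proof.
move=> bF; have [mF [C FC]] := bF.
have bFC : bmeas (fun y => F y + C) by exact: bmeasD bF (bmeas_cst _ _).
have FC0 y : 0 <= F y + C.
  by rewrite -lerBlDr sub0r; have := FC y; rewrite ler_norml => /andP[].
have P1 := probability_setT P.
have b1 : bmeas (fun om => F (U om, V om)) := bmeas_comp mUV bF.
have b2 : bmeas (fun om => \int[k (U om)]_b F (U om, b)).
  exact: bmeas_comp mU (bmeas_kernel_integral bF).
have bC := bmeas_cst Omega C.
have kC om : \int[k (U om)]_b (F (U om, b) + C) = \int[k (U om)]_b F (U om, b) + C.
  rewrite bintegralD ?bintegral_cst//; try exact: prob_kernel.
  - exact: bmeas_section.
  - exact: bmeas_cst.
have := ge0_freezing FC0 bFC; rewrite bintegralD//.
under [in RHS]eq_Rintegral do rewrite kC.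
by rewrite bintegralD// => /addIr.
Qed.

End bounded_disintegration.

(** * Almost sure convergence of L2 martingales *)

Section filtration.
Context (R : realType) (d : measure_display) (Omega : measurableType d).
Variable G : nat -> set (set Omega).
Hypothesis Gm : forall t, G t `<=` measurable.
Hypothesis GS : forall t, G t `<=` <<s G t.+1 >>.

(** [G t] is a mere generating family; the filtration consists of the sigma-algebras that these
    families generate. Boundedness is part of the notion. *)
Definition adapted (t : nat) (f : Omega -> R) :=
  bmeas (f : g_sigma_algebraType (G t) -> R).

Lemma adapted_bmeas t f : adapted t f -> bmeas f.
Proof.
apply: (@bmeas_comp _ _ _ (g_sigma_algebraType (G t)) Omega id).
move=> _ A mA; rewrite setTI preimage_id.
by apply: (smallest_sub _ (@Gm t)) A mA; exact: sigma_algebra_measurable.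
Qed.

Lemma adaptedS t f : adapted t f -> adapted t.+1 f.
Proof.
apply: (@bmeas_comp _ _ _ (g_sigma_algebraType (G t))
  (g_sigma_algebraType (G t.+1)) id).
move=> _ A mA; rewrite setTI preimage_id.
by apply: (smallest_sub _ (@GS t)) A mA; exact: smallest_sigma_algebra.
Qed.

End filtration.

Section martingale.
Context (R : realType) (d : measure_display) (Omega : measurableType d).
Variables (P : probability Omega R) (G : nat -> set (set Omega)).
Hypothesis Gm : forall t, G t `<=` measurable.
Hypothesis GS : forall t, G t `<=` <<s G t.+1 >>.

Section maximal_inequality.
Variable D : nat -> Omega -> R.
Hypothesis aD : forall t, adapted G t.+1 (D t).
Hypothesis D0 : forall t f, adapted G t f -> \int[P]_om (f om * D t om) = 0.

Variable l : R.
Hypothesis l0 : 0 < l.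

(* the partial sums of D, frozen when they first leave [-l, l] *)
Fixpoint stopped (n : nat) (om : Omega) : R :=
  if n is n'.+1 then
    stopped n' om + (`|stopped n' om| <= l)%R%:R * D n' om
  else 0.

Let bmeas_inside d' (T : measurableType d') (f : T -> R) :
  bmeas f -> bmeas (fun om => (`|f om| <= l)%R%:R : R).
Proof.
move=> bf; split; last first.
  by exists 1 => om; case: (_ <= l) => /=; rewrite ?normr1 ?normr0 ?ler01.
rewrite (_ : (fun om => _) = \1_(f @^-1` [set y | `|y| <= l])); last first.
  apply/funext => om; rewrite indicE; congr ((nat_of_bool _)%:R).
  by apply/idP/idP => [/mem_set//|/set_mem].
apply: measurable_indic; rewrite -[X in measurable X]setTI.
have [mf _] := bf; apply: mf => //.
rewrite (_ : [set _ | _] = `[- l, l]%classic)//.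
by apply/seteqP; split => y /=; rewrite in_itv/= ler_norml.
Qed.

Lemma adapted_stopped n : adapted G n (stopped n).
Proof.
elim: n => [|n ih]; first exact: bmeas_cst.
apply: bmeasD; first exact: (adaptedS GS).
by apply: bmeasM; [apply: bmeas_inside; exact: (adaptedS GS)|exact: aD].
Qed.

(** [D0] is the martingale property, a zero conditional mean tested against bounded variables of the
    past. When the square is expanded, the cross term is such a variable times [D n] and integrates
    to zero. *)
Lemma sqr_stopped n :
  \int[P]_om (stopped n om ^+ 2) <= \sum_(k < n) \int[P]_om (D k om ^+ 2).
Proof.
have P1 := probability_setT P.
elim: n => [|n ih].
  rewrite big_ord0 -[leRHS](bintegral_cst P1) le_eqVlt; apply/orP; left.
  by apply/eqP/eq_Rintegral => om _; rewrite /= expr0n.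
have aN := adapted_stopped n.
have aI : adapted G n (fun om => (`|stopped n om| <= l)%R%:R : R).
  exact: bmeas_inside.
have bN := adapted_bmeas Gm aN.
have bI := adapted_bmeas Gm aI.
have bD := adapted_bmeas Gm (aD n).
pose A om := 2 * (stopped n om * (`|stopped n om| <= l)%R%:R) * D n om.
have bA : bmeas A.
  by apply: bmeasM => //; apply: bmeasM; [exact: bmeas_cst|exact: bmeasM].
have A0 : \int[P]_om A om = 0.
  by apply: D0; apply: bmeasM; [exact: bmeas_cst|exact: bmeasM].
have b1 := bmeasX 2 bN; have b2 := bmeasX 2 bD.
rewrite big_ord_recr /=; apply: le_trans (lerD ih (lexx _)).
rewrite -bintegralD// -[leRHS]addr0 -A0 -bintegralD//; last exact: bmeasD.
apply: ler_bintegral => //.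
- by apply: bmeasX; apply: bmeasD => //; exact: bmeasM.
- by do 2 apply: bmeasD => //.
move=> om; rewrite /A; case: (_ <= l).
  by rewrite mul1r mulr1 sqrrD -mulr_natl mulrA addrAC.
by rewrite !(mul0r, mulr0, addr0) lerDl sqr_ge0.
Qed.

(** Freezing is irreversible: a stopped sum that has left the interval stays outside. Being inside
    at time [n] thus means that nothing has been frozen so far. *)
Lemma stopped_inside n om : `|stopped n om| <= l ->
  forall k, (k <= n)%N -> stopped n om = \sum_(j < n) D j om /\
    `|\sum_(j < k) D j om| <= l.
Proof.
elim: n => [|n ih] /=.
  by move=> _ k; rewrite leqn0 => /eqP ->; rewrite big_ord0 normr0 ltW.
have [le_l|gt_l] := boolP (`|stopped n om| <= l); last first.
  by rewrite mul0r addr0 (negbTE gt_l).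
rewrite mul1r; have [-> _] := ih le_l _ (leqnn _).
rewrite -(@big_ord_recr _ _ _ n (fun j : 'I_n.+1 => D j om)) /= => SD k.
rewrite leq_eqVlt => /predU1P[->//|]; rewrite ltnS => kn; split => //.
by case: (ih le_l _ kn).
Qed.

(** The Doob-Kolmogorov inequality. The events that the stopped sum is outside at time n increase
    with n, so Chebyshev at each n and continuity from below bound the probability of their union
    [B], which contains every large excursion. *)
Lemma maximal_inequality s :
  (forall n, \sum_(k < n) \int[P]_om (D k om ^+ 2) <= s) ->
  exists2 B, measurable B & (P B <= (s / l ^+ 2)%:E)%E /\
    forall om n, l < `|\sum_(j < n) D j om| -> B om.
Proof.
move=> Ds; pose F n := [set om | l < `|stopped n om|].
have mF n : measurable (F n).
  have [mN _] := adapted_bmeas Gm (adapted_stopped n).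
  rewrite -[X in measurable X]setTI.
  have -> : F n = stopped n @^-1` (~` `[- l, l]%classic).
    by apply/seteqP; split => om; rewrite /F/= in_itv/= -ler_norml ltNge => /negP.
  by apply: mN => //; exact: measurableC.
have FS n : F n `<=` F n.+1.
  move=> om /= Fn; rewrite /F/= (_ : (_ <= l) = false) ?mul0r ?addr0//.
  by apply/negbTE; rewrite -ltNge.
have ndF : nondecreasing_seq F by apply/nondecreasing_seqP => n; apply/subsetPset.
exists (\bigcup_n F n); first exact: bigcupT_measurable.
split.
  have cF : P (F n) @[n --> \oo] --> P (\bigcup_n F n).
    by apply: nondecreasing_cvg_mu => //; exact: bigcupT_measurable.
  rewrite -(cvg_lim _ cF)//; apply: lime_le; first exact: cvgP cF.
  apply: nearW => n /=.
  have l20 : 0 < l ^+ 2 by rewrite exprn_gt0.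
  rewrite -(@lee_pmul2l _ (l ^+ 2)%:E) ?fin_numE// ?lte_fin//.
  rewrite -EFinM mulrCA divff ?gt_eqF// mulr1.
  have bN2 := bmeasX 2 (adapted_bmeas Gm (adapted_stopped n)).
  have mN2 : measurable_fun setT (fun om => (stopped n om ^+ 2)%:E).
    by apply/measurable_EFinP; case: bN2.
  apply: (@le_trans _ _ (\int[P]_om (stopped n om ^+ 2)%:E)%E).
    have := @le_integral_abse _ _ _ P _ measurableT _ _ mN2 l20.
    under eq_integral do rewrite gee0_abs ?lee_fin ?sqr_ge0//.
    apply: le_trans; apply: lee_wpmul2l; first by rewrite lee_fin ltW.
    apply: le_measure; rewrite ?inE.
    - exact: mF.
    - apply: emeasurable_fun_c_infty => //; exact: measurableT_comp.
    - move=> om Fn; split => //=; rewrite lee_fin normrX ler_sqr ?nnegrE ?normr_ge0 ?ltW//.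
  rewrite -(EFin_Rintegral (probability_setT P) bN2) lee_fin.
  exact: le_trans (sqr_stopped n) (Ds n).
move=> om n lM; exists n => //; rewrite /F/= ltNge; apply/negP => /stopped_inside.
by move=> /(_ n (leqnn _))[_]; rewrite leNgt lM.
Qed.

End maximal_inequality.
End martingale.

Lemma seriesDn (V : zmodType) (v : nat -> V) m n :
  series v (m + n)%N = series v m + \sum_(k < n) v (m + k)%N.
Proof.
elim: n => [|n ih]; first by rewrite addn0 big_ord0 addr0.
by rewrite addnS big_ord_recr seriesSr ih /= addrA.
Qed.

Section martingale_convergence.
Context (R : realType) (d : measure_display) (Omega : measurableType d).
Variables (P : probability Omega R) (G : nat -> set (set Omega)).
Hypothesis Gm : forall t, G t `<=` measurable.
Hypothesis GS : forall t, G t `<=` <<s G t.+1 >>.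
Variable D : nat -> Omega -> R.
Hypothesis aD : forall t, adapted G t.+1 (D t).
Hypothesis D0 : forall t f, adapted G t f -> \int[P]_om (f om * D t om) = 0.
Hypothesis D2 : cvgn (series (fun t => \int[P]_om (D t om ^+ 2))).

Let u t := \int[P]_om (D t om ^+ 2).

Let u_ge0 t : 0 <= u t.
Proof. by apply: Rintegral_ge0 => om _; exact: sqr_ge0. Qed.

(** Applied to the increments after time m, the maximal inequality bounds the probability of an
    oscillation above [l] by a tail of the variance series over [l ^+ 2]. This tends to 0 with m, so
    almost surely some m has no such oscillation, for each l = 1/(k+1): the partial sums are
    Cauchy. *)
Lemma L2_martingale_cvg : {ae P, forall om, cvgn (series (D ^~ om))}.
Proof.
have tail (l : R) m : 0 < l -> exists2 B, measurable B &
    (P B <= ((limn (series u) - series u m) / l ^+ 2)%:E)%E /\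
    forall om n, l < `|series (D ^~ om) (m + n)%N - series (D ^~ om) m| -> B om.
  move=> l0.
  have Gm' t : G (m + t)%N `<=` measurable by exact: Gm.
  have GS' t : G (m + t)%N `<=` <<s G (m + t.+1)%N >> by rewrite addnS; exact: GS.
  have aD' t : adapted (fun t => G (m + t)%N) t.+1 (D (m + t)%N).
    by rewrite /adapted addnS; exact: aD.
  have [|B mB [PB lB]] := @maximal_inequality _ _ _ P _ Gm' GS' (fun t => D (m + t)%N)
    aD' (fun t f => @D0 (m + t)%N f) l l0 (limn (series u) - series u m).
    move=> n; rewrite lerBrDl (_ : _ + _ = series u (m + n)%N).
      apply: nondecreasing_cvgn_le => //.
      by apply/nondecreasing_seqP => k; rewrite seriesSr lerDl.
    by rewrite -seriesDn.
  exists B => //; split => // om n; rewrite seriesDn [X in `|X|]addrC addKr.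
  exact: lB.
have small (l : R) : 0 < l -> {ae P, forall om, exists m, forall n,
    `|series (D ^~ om) (m + n)%N - series (D ^~ om) m| <= l}.
  move=> l0; pose B m := projT1 (cid2 (tail l m l0)).
  have mB m : measurable (B m) by rewrite /B; case: cid2.
  have PB m : (P (B m) <= ((limn (series u) - series u m) / l ^+ 2)%:E)%E.
    by rewrite /B; case: cid2 => ? ? [].
  have lB m om n : l < `|series (D ^~ om) (m + n)%N - series (D ^~ om) m| -> B m om.
    by rewrite /B; case: cid2 => ? ? [? +]; exact.
  exists (\bigcap_m B m); split; first exact: bigcapT_measurable.
    apply/eqP; rewrite eq_le measure_ge0 andbT.
    apply/lee_addgt0Pr => e e0; rewrite add0e.
    have : (limn (series u) - series u m) / l ^+ 2 @[m --> \oo] --> 0.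
      rewrite -[X in _ --> X](mul0r (l ^- 2)); apply: cvgMl.
      by rewrite -(subrr (limn (series u))); apply: cvgB => //; exact: cvg_cst.
    move=> /cvgrPdist_lt /(_ e e0) [m _ /(_ m (leqnn m))].
    rewrite /= sub0r normrN => /ltW /(le_trans (ler_norm _)) le_e.
    apply: (@le_trans _ _ (P (B m))).
      by apply: le_measure; rewrite ?inE//; [exact: bigcapT_measurable|exact: bigcap_inf].
    by rewrite (le_trans (PB m))// lee_fin.
  move=> om /= H m _; apply: contrapT => Bm; apply: H; exists m => n.
  by rewrite leNgt; apply/negP => /lB.
have : {ae P, forall om, forall k, exists m, forall n,
    `|series (D ^~ om) (m + n)%N - series (D ^~ om) m| <= k.+1%:R^-1}.
  by apply: ae_foralln => k; apply: small; rewrite invr_gt0.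
apply: filterS => om H; apply: cauchy_cvg; apply: cauchy_exP => e e0.
have [k ke] : exists k, k.+1%:R^-1 < e :> R.
  have [k _ /(_ k (leqnn k)) ke] := near_infty_natSinv_lt (PosNum e0).
  by exists k.
have [m Hm] := H k; exists (series (D ^~ om) m); exists m => // n /= mn.
rewrite /ball/= distrC -(subnKC mn); exact: le_lt_trans (Hm _) ke.
Qed.

End martingale_convergence.

(** * Deterministic recursions *)

Section real_sequences.
Context (R : realType).
Implicit Types u v : nat -> R.

Lemma ge0_cvg_series u M : (forall n, 0 <= u n) -> (forall n, series u n <= M) ->
  cvgn (series u).
Proof.
move=> u0 uM; apply: nondecreasing_is_cvgn.
  by apply/nondecreasing_seqP => n; rewrite seriesSr lerDl.
by exists M => _ [n _ <-].
Qed.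

Lemma series_le_lim u n : (forall n, 0 <= u n) -> cvgn (series u) ->
  series u n <= limn (series u).
Proof.
move=> u0 cu; apply: nondecreasing_cvgn_le => //.
by apply/nondecreasing_seqP => k; rewrite seriesSr lerDl.
Qed.

Lemma ge0_le_cvg_series u v : (forall n, 0 <= u n) -> (forall n, u n <= v n) ->
  cvgn (series v) -> cvgn (series u).
Proof.
move=> u0 uv cv; have v0 n : 0 <= v n by exact: le_trans (uv n).
apply: (ge0_cvg_series (M := limn (series v))) => // n.
by apply: le_trans (series_le_lim n v0 cv); apply: ler_sum.
Qed.

Lemma cvg_seriesZ u c : cvgn (series u) -> cvgn (series (fun n => c * u n)).
Proof.
move=> cu; rewrite [X in cvgn X](_ : _ = fun n => c * series u n).
  by apply: is_cvgMr.
by apply/funext => n; rewrite /series/= mulr_sumr.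
Qed.

Section lyapunov.
Variables (alpha eps U v kap : nat -> R) (C c : R).
Hypotheses (C0 : 0 <= C) (c0 : 0 < c).
Hypotheses (alpha0 : forall t, 0 < alpha t) (alpha_cvg : alpha @ \oo --> 0).
Hypotheses (eps0 : forall t, 0 <= eps t) (eps_cvg : cvgn (series eps)).
Hypotheses (v0 : forall t, 0 <= v t) (kap0 : forall t, 0 <= kap t).
Hypothesis Uv : forall t, v t <= U t + C * alpha t * v t.
Hypothesis US : forall t, U t.+1 <= U t - c * alpha t * kap t + C * eps t * v t.

(** [U] is [v] plus a correction of unknown sign. As soon as C alpha_t < 1/2 it dominates v/2, and
    the recursion becomes U_{t+1} + c alpha_t kap_t <= (1 + 2 C eps_t) U_t. Discrete Gronwall bounds
    [U], and summing the recursion then bounds the dissipation. *)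
Lemma lyapunov_bound :
  (exists M, forall t, v t <= M) /\ cvgn (series (fun t => alpha t * kap t)).
Proof.
have [T HT] : exists T, forall t, (T <= t)%N -> v t <= 2 * U t.
  have : C * alpha t @[t --> \oo] --> 0.
    by rewrite -(mulr0 C); apply: cvgMr.
  have h2 : (0 : R) < 2^-1 by rewrite invr_gt0.
  move=> /cvgrPdist_lt /(_ _ h2)[T _ HT]; exists T => t /HT /=.
  rewrite sub0r normrN => /(le_lt_trans (ler_norm _))/ltW h.
  have := ler_wpM2r (v0 t) h; have := Uv t; lra.
(* The Gronwall factor: it dominates the product of the 1 + 2 C eps_t from [T] on, through 1 + x <=
   exp x. *)
pose E n := expR (2 * C * (series eps n - series eps T)).
have U0 t : (T <= t)%N -> 0 <= U t by move=> /HT; have := v0 t; lra.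
have US' t : (T <= t)%N ->
    U t.+1 + c * alpha t * kap t <= U t + 2 * C * eps t * U t.
  move=> /HT h; have := US t; have := ler_wpM2l (mulr_ge0 C0 (eps0 t)) h; lra.
have ca t : 0 <= c * alpha t * kap t.
  by rewrite !mulr_ge0// ltW.
have UE n : U (T + n)%N <= U T * E (T + n)%N.
  elim: n => [|n ih]; first by rewrite addn0 /E subrr mulr0 expR0 mulr1.
  have Tn := leq_addr n T; rewrite addnS.
  have -> : E (T + n).+1 = E (T + n)%N * expR (2 * C * eps (T + n)%N).
    by rewrite /E -expRD seriesSr; congr expR; ring.
  rewrite mulrA; apply: (@le_trans _ _ (U (T + n)%N * (1 + 2 * C * eps (T + n)%N))).
    by have := US' _ Tn; have := ca (T + n)%N; lra.
  apply: ler_pM => //; first exact: U0.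
    by rewrite addr_ge0// !mulr_ge0.
  exact: expR_ge1Dx.
have [M UM] : exists M, forall t, (T <= t)%N -> U t <= M.
  exists (U T * expR (2 * C * (limn (series eps) - series eps T))) => t Tt.
  rewrite -(subnKC Tt); apply: le_trans (UE _) _.
  apply: ler_wpM2l; first exact: U0.
  rewrite ler_expR; apply: ler_wpM2l; first exact: mulr_ge0.
  by rewrite lerB// series_le_lim.
split.
  exists (\sum_(t < T) v t + 2 * M) => t; have [Tt|tT] := leqP T t.
    apply: le_trans (HT _ Tt) _; rewrite -[leLHS]add0r lerD//; first exact: sumr_ge0.
    by rewrite ler_pM2l// UM.
  rewrite (bigD1 (Ordinal tT))//= -addrA lerDl addr_ge0//; first exact: sumr_ge0.
  by rewrite mulr_ge0// (le_trans (U0 T _))// UM.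
have M0 : 0 <= M by rewrite (le_trans (U0 T _))// UM.
apply: (ge0_cvg_series (M := series (fun t => alpha t * kap t) T +
    c^-1 * (U T + 2 * C * M * limn (series eps)))).
  by move=> n; rewrite mulr_ge0// ltW.
have ak0 t : 0 <= alpha t * kap t by rewrite mulr_ge0// ltW.
move=> n; apply: (@le_trans _ _ (series (fun t => alpha t * kap t) (T + n)%N)).
  by rewrite addnC seriesDn lerDl sumr_ge0.
rewrite seriesDn lerD2l.
have {}UE k : U (T + k)%N + c * \sum_(i < k) alpha (T + i)%N * kap (T + i)%N
    <= U T + 2 * C * M * \sum_(i < k) eps (T + i)%N.
  elim: k => [|k ih]; first by rewrite !big_ord0 !mulr0 addn0.
  have Tk := leq_addr k T.
  rewrite !big_ord_recr/= addnS; have := US' _ Tk.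
  have := ler_wpM2l (mulr_ge0 (mulr_ge0 (ler0n R 2) C0) (eps0 (T + k)%N)) (UM _ Tk).
  by move: ih; lra.
have sc : 0 <= series eps T by exact: sumr_ge0.
have se : 2 * C * M * \sum_(i < n) eps (T + i)%N <= 2 * C * M * limn (series eps).
  apply: ler_wpM2l; first by rewrite !mulr_ge0.
  by have := series_le_lim (T + n) eps0 eps_cvg; rewrite seriesDn; lra.
rewrite mulrC ler_pdivlMr// mulrC.
by have := UE n; have := U0 _ (leq_addr n T); lra.
Qed.

End lyapunov.

(** [rho] is small at arbitrarily late times, since [alpha] is not summable. Where rho >= e/2, an
    increment C alpha rho is at most (2C/e) alpha rho^2, which is summable; so after a late small
    value [sig], which shadows [rho], cannot climb back above 2e. *)
Lemma cvg0_of_summable (alpha rho sig : nat -> R) (C : R) : 0 <= C ->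
  (forall t, 0 < alpha t) -> alpha @ \oo --> 0 -> series alpha @ \oo --> +oo ->
  (forall t, 0 <= rho t) -> cvgn (series (fun t => alpha t * rho t ^+ 2)) ->
  (forall t, sig t.+1 <= sig t + C * alpha t * rho t) ->
  sig t - rho t @[t --> \oo] --> 0 -> rho @ \oo --> 0.
Proof.
move=> C0 alpha0 alpha_cvg alpha_oo rho0 cS sigS sr.
set S := series _ in cS.
suff sig0 e : 0 < e -> \forall t \near \oo, sig t <= 2 * e.
  apply/cvgrPdist_le => e e0;
  have e4 : 0 < e / 4 by rewrite divr_gt0.
  have h := sig0 _ e4; move/cvgrPdist_le : sr => /(_ _ e4) sr.
  near=> t; rewrite sub0r normrN ger0_norm//.
  have : sig t <= 2 * (e / 4) by near: t.
  have : `|0 - (sig t - rho t)| <= e / 4 by near: t.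
  rewrite sub0r normrN ler_norml => /andP[]; lra.
move=> e0.
have aS t : 0 <= alpha t * rho t ^+ 2 by rewrite mulr_ge0// ?sqr_ge0// ltW.
(* Chosen so that C rho <= K rho^2 whenever rho >= e/2. *)
pose K := 2 * C / e.
have K0 : 0 <= K by rewrite divr_ge0 ?mulr_ge0// ltW.
have e4 : 0 < e / 4 by rewrite divr_gt0.
have car : C * (alpha t * (1 + rho t ^+ 2)) @[t --> \oo] --> 0.
  have h : alpha t + alpha t * rho t ^+ 2 @[t --> \oo] --> 0 + 0.
    by apply: cvgD => //; exact: cvg_series_cvg_0.
  rewrite addr0 in h; rewrite -(mulr0 C); apply: cvgMr.
  suff -> : (fun t => alpha t * (1 + rho t ^+ 2)) =
    (fun t => alpha t + alpha t * rho t ^+ 2) by [].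
  by apply/funext => t; rewrite mulrDr mulr1.
have KS : K * (limn S - S t) @[t --> \oo] --> 0.
  rewrite -(mulr0 K); apply: cvgMr; rewrite -(subrr (limn S)).
  by apply: cvgB => //; exact: cvg_cst.
move/cvgrPdist_le : sr => /(_ _ e4)[T1 _ H1].
move/cvgrPdist_le : car => /(_ _ e4)[T2 _ H2].
move/cvgrPdist_le : KS => /(_ _ e0)[T3 _ H3].
pose T := maxn T1 (maxn T2 T3).
(* Otherwise alpha_t <= (4 / e^2) alpha_t rho_t^2 for all t >= T, and the series of [alpha] would be
   bounded. *)
have [t0 Tt0 rt0] : exists2 t0, (T <= t0)%N & rho t0 <= e / 2.
  apply: contrapT => H.
  have {}H t : (T <= t)%N -> e / 2 < rho t.
    by move=> Tt; rewrite ltNge; apply/negP => ?; apply: H; exists t.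
  move/cvgryPge : alpha_oo => /(_ (series alpha T + 4 / e ^+ 2 * limn S + 1)).
  move=> [N _ /(_ (T + N)%N (leq_addl _ _))] /=.
  rewrite seriesDn; apply/negP; rewrite -ltNge -!addrA ltrD2l.
  rewrite (@le_lt_trans _ _ (4 / e ^+ 2 * limn S))// ?ltrDl//.
  have sl : \sum_(k < N) alpha (T + k)%N * rho (T + k)%N ^+ 2 <= limn S.
    have := series_le_lim (T + N) aS cS; rewrite seriesDn.
    by apply: le_trans; rewrite lerDr sumr_ge0.
  apply: (@le_trans _ _ (4 / e ^+ 2 * \sum_(k < N) alpha (T + k)%N * rho (T + k)%N ^+ 2)).
    rewrite mulr_sumr; apply: ler_sum => k _.
    rewrite mulrCA -[leLHS]mulr1 ler_pM2l// mulrAC ler_pdivlMr ?exprn_gt0//.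
    rewrite mul1r.
    have h := H _ (leq_addr k T).
    have -> : e ^+ 2 = 4 * (e / 2) ^+ 2 by field.
    by rewrite ler_pM2l// ler_sqr ?nnegrE// ltW// divr_gt0.
  by rewrite ler_wpM2l// divr_ge0// ltW// exprn_gt0.
(* If rho_t >= e/2 the increment is paid by the new term of the sum. If rho_t < e/2 the past is
   forgotten: sig_t <= rho_t + e/4 < 3e/4, and one step adds at most e/4. The choice of [T3] keeps
   the whole sum below e. *)
have main n : sig (t0 + n)%N <= e + K * \sum_(k < n) alpha (t0 + k)%N * rho (t0 + k)%N ^+ 2.
  elim: n => [|n ih].
    rewrite addn0 big_ord0 mulr0 addr0.
    have /H1 : (T1 <= t0)%N by rewrite (leq_trans _ Tt0)// leq_maxl.
    by rewrite /= sub0r normrN ler_norml => /andP[]; move: rt0; lra.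
  rewrite addnS big_ord_recr/= mulrDr addrA; set t := (t0 + n)%N.
  have Tt : (T <= t)%N by rewrite (leq_trans Tt0)// leq_addr.
  apply: le_trans (sigS t) _.
  have [re|re] := leP (e / 2) (rho t).
    rewrite lerD// -mulrA (_ : K * _ = C * (alpha t * (rho t * (rho t * (2 / e))))); last first.
      by rewrite /K; field; rewrite gt_eqF.
    apply: ler_wpM2l => //; apply: ler_wpM2l; first exact: ltW.
    rewrite -[leLHS]mulr1; apply: ler_wpM2l => //.
    by rewrite mulrA ler_pdivlMr// mul1r; move: re; lra.
  have /H1 : (T1 <= t)%N by rewrite (leq_trans _ Tt)// leq_maxl.
  have /H2 : (T2 <= t)%N by rewrite (leq_trans _ Tt)// !leq_max leqnn orbT.
  rewrite /= !sub0r !normrN !ler_norml => /andP[_ h2] /andP[h1 h1'].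
  have h3 : C * alpha t * rho t <= e / 4.
    apply: le_trans h2; rewrite -mulrA; apply: ler_wpM2l => //.
    apply: ler_wpM2l; first exact: ltW.
    by have := sqr_ge0 (rho t - 1); rewrite sqrrB1 -mulr_natr; have := rho0 t; nra.
  have h4 : 0 <= K * \sum_(k < n) alpha (t0 + k)%N * rho (t0 + k)%N ^+ 2.
    by rewrite mulr_ge0// sumr_ge0.
  have h5 : 0 <= K * (alpha t * rho t ^+ 2) by rewrite mulr_ge0.
  lra.
exists t0 => // t /= t0t; rewrite -(subnKC t0t); apply: le_trans (main _) _.
rewrite mulrDl mul1r lerD2l.
have /H3 : (T3 <= t0)%N by rewrite (leq_trans _ Tt0)// !leq_max leqnn !orbT.
rewrite /= sub0r normrN => /(le_trans (ler_norm _)); apply: le_trans.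
apply: ler_wpM2l => //; rewrite lerBrDl.
by have := series_le_lim (t0 + (t - t0)) aS cS; rewrite seriesDn.
Unshelve. all: by end_near. Qed.

End real_sequences.

(** * Euclidean estimates and the one-step energy inequality *)

Section vectors.
Context (R : realType) (n : nat).
Implicit Types u v w : 'cV[R]_n.

Definition sqn v := dotp v v.

Lemma dotpDl u v w : dotp (u + v) w = dotp u w + dotp v w.
Proof. by rewrite /dotp -big_split; apply: eq_bigr => i _; rewrite mxE mulrDl. Qed.

Lemma dotpC u v : dotp u v = dotp v u.
Proof. by apply: eq_bigr => i _; rewrite mulrC. Qed.

Lemma dotpDr u v w : dotp w (u + v) = dotp w u + dotp w v.
Proof. by rewrite dotpC dotpDl !(dotpC w). Qed.

Lemma dotpZl a u v : dotp (a *: u) v = a * dotp u v.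
Proof. by rewrite /dotp mulr_sumr; apply: eq_bigr => i _; rewrite mxE mulrA. Qed.

Lemma dotpZr a u v : dotp u (a *: v) = a * dotp u v.
Proof. by rewrite dotpC dotpZl dotpC. Qed.

Lemma dotpBl u v w : dotp (u - v) w = dotp u w - dotp v w.
Proof. by rewrite dotpDl -scaleN1r dotpZl mulN1r. Qed.

Lemma sqn_ge0 v : 0 <= sqn v.
Proof. by apply: sumr_ge0 => i _; rewrite -expr2 sqr_ge0. Qed.

Lemma le_sqn v i : v i 0 ^+ 2 <= sqn v.
Proof.
rewrite /sqn /dotp (bigD1 i)//= -expr2 lerDl.
by apply: sumr_ge0 => j _; rewrite -expr2 sqr_ge0.
Qed.

Lemma ler_norm_dotp u v : `|dotp u v| <= sqn u + sqn v.
Proof.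
rewrite /sqn /dotp -big_split; apply: le_trans (ler_norm_sum _ _ _) _.
apply: ler_sum => i _ /=; rewrite normrM -!expr2 -[u i 0 ^+ 2]real_normK ?num_real//.
rewrite -[v i 0 ^+ 2]real_normK ?num_real//.
by have := normr_ge0 (u i 0); have := normr_ge0 (v i 0); nra.
Qed.

(** A crude Cauchy-Schwarz from a_i a_j <= a_i^2 + a_j^2; only the existence of a constant matters
    later on. *)
Lemma sqr_sum_le (I : finType) (a : I -> R) :
  (\sum_i a i) ^+ 2 <= 2 * #|I|%:R * \sum_i a i ^+ 2.
Proof.
rewrite expr2 mulr_suml.
apply: (@le_trans _ _ (\sum_i \sum_j (a i ^+ 2 + a j ^+ 2))).
  apply: ler_sum => i _; rewrite mulr_sumr; apply: ler_sum => j _.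
  by have := sqr_ge0 (a i - a j); rewrite sqrrB; have := sqr_ge0 (a i); have := sqr_ge0 (a j); nra.
rewrite le_eqVlt; apply/orP; left; apply/eqP.
under eq_bigr do rewrite big_split /= sumr_const.
rewrite big_split /= sumr_const -sumrMnl -mulr_natl.
by under eq_bigr do rewrite -mulr_natl; rewrite -mulr_sumr; ring.
Qed.

Lemma sqn_mulmx (m : nat) (M : 'M[R]_(m, n)) (K : R) v :
  (forall i j, `|M i j| <= K) ->
  \sum_(i < m) (M *m v) i 0 ^+ 2 <= m%:R * (2 * n%:R * K ^+ 2) * sqn v.
Proof.
move=> MK; rewrite -mulrA -[in leRHS](card_ord m) mulr_natl -sumr_const.
apply: ler_sum => i _; rewrite mxE; apply: le_trans (sqr_sum_le _) _.
rewrite card_ord -[leRHS]mulrA ler_wpM2l// mulr_sumr; apply: ler_sum => j _.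
rewrite exprMn -expr2 ler_wpM2r ?sqr_ge0//.
by rewrite -[leLHS]real_normK ?num_real// ler_sqr ?nnegrE// (le_trans _ (MK i j)).
Qed.

Lemma sqn_bounded_mulmx (M : 'M[R]_n) (K b : R) v :
  (forall i j, `|M i j| <= K) -> n%:R * (2 * n%:R * K ^+ 2) <= b ->
  sqn (M *m v) <= b * sqn v.
Proof.
move=> MK Kb; apply: le_trans (ler_wpM2r (sqn_ge0 v) Kb).
by apply: le_trans (sqn_mulmx v MK); rewrite /sqn /dotp; under eq_bigr do rewrite -expr2.
Qed.

(** Moments use the quadratic [sqn]; the pathwise argument needs the triangle inequality, which the
    l1 norm inherits from the coordinates. *)
Definition norm1 v := \sum_i `|v i 0|.

Lemma norm1_ge0 v : 0 <= norm1 v.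
Proof. exact: sumr_ge0. Qed.

Lemma norm1D u v : norm1 (u + v) <= norm1 u + norm1 v.
Proof.
by rewrite /norm1 -big_split; apply: ler_sum => i _; rewrite mxE ler_normD.
Qed.

Lemma norm1Z a v : norm1 (a *: v) = `|a| * norm1 v.
Proof. by rewrite /norm1 mulr_sumr; apply: eq_bigr => i _; rewrite mxE normrM. Qed.

Lemma norm1_sqr v : norm1 v ^+ 2 <= 2 * n%:R * sqn v.
Proof.
apply: le_trans (sqr_sum_le _) _; rewrite card_ord le_eqVlt; apply/orP; left.
apply/eqP; congr (_ * _); apply: eq_bigr => i _.
by rewrite real_normK ?num_real// expr2.
Qed.

Lemma norm1_mulmx (M : 'M[R]_n) v :
  norm1 (M *m v) <= (\sum_i \sum_j `|M i j|) * norm1 v.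
Proof.
rewrite /norm1 mulr_suml; apply: ler_sum => i _.
rewrite mxE (le_trans (ler_norm_sum _ _ _))// mulr_suml; apply: ler_sum => j _.
by rewrite normrM ler_wpM2l// (bigD1 j)//= lerDl sumr_ge0.
Qed.

(* N and M are values of a Poisson solution and of its mean, so that
   A + N - M is the random matrix driving the iteration. *)
Lemma lyapunov_step (A N M : 'M[R]_n) (z : 'cV[R]_n) (b a a' a0 : R) :
  0 <= b -> 0 <= a' -> a' <= a -> a <= a0 ->
  (forall v, sqn (M *m v) <= b * sqn v) ->
  (forall v, sqn ((A + N - M) *m v) <= b * sqn v) ->
  let z' := z + a *: ((A + N - M) *m z) in
  sqn z' + 2 * a' * dotp z' (M *m z') <=
  sqn z + 2 * a * dotp z (A *m z) + 2 * a * dotp z (N *m z)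
    + (b + 2 * (1 + b) + 2 * (2 + a0) * (1 + b) ^+ 2) * (a ^+ 2 + (a - a')) * sqn z.
Proof.
move=> b0 a'0 a'a aa0 hM hB /=; set B := A + N - M.
set s := sqn z; set w := B *m z.
have s0 : 0 <= s := sqn_ge0 z.
have hw : sqn w <= b * s := hB z.
have hMw : sqn (M *m w) <= b * (b * s).
  by apply: le_trans (hM w) _; rewrite ler_wpM2l.
have := ler_norm_dotp z (M *m z); rewrite ler_norml => /andP[d0 d0'].
have := ler_norm_dotp z (M *m w); rewrite ler_norml => /andP[_ d1].
have := ler_norm_dotp w (M *m z); rewrite ler_norml => /andP[_ d2].
have := ler_norm_dotp w (M *m w); rewrite ler_norml => /andP[_ d3].
have hz := hM z; rewrite -/s in hz.
(* The cross term of |z'|^2 yields -2a z^T M z and the correction yields +2a' z^T M z, leaving -2(a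
   - a') z^T M z, whence the 2(1 + b) of the constant. All other remainders carry a^2: [b] comes
   from |w|^2, and 2(2 + a0)(1 + b)^2 from [q1], [q2] and [q3]. *)
have zw : dotp z w = dotp z (A *m z) + dotp z (N *m z) - dotp z (M *m z).
  rewrite /w /B !mulmxDl mulNmx !dotpDr; congr (_ + _ + _).
  by rewrite -scaleN1r dotpZr mulN1r.
rewrite mulmxDr -scalemxAr /sqn !(dotpDl, dotpDr, dotpZl, dotpZr).
rewrite (dotpC w z) zw -/(sqn z) -/(sqn w) -/s.
move: d0 d0' d1 d2 d3; rewrite -/s.
set p := dotp z (M *m z); set q1 := dotp z (M *m w); set q2 := dotp w (M *m z).
set q3 := dotp w (M *m w); set p1 := dotp z (A *m z); set p2 := dotp z (N *m z).
move=> d0 d0' d1 d2 d3.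
have a_ge0 : 0 <= a by exact: le_trans a'a.
have a0_ge0 : 0 <= a0 by exact: le_trans aa0.
have e1 : a ^+ 2 * sqn w <= a ^+ 2 * (b * s) by rewrite ler_wpM2l// sqr_ge0.
have e2 : - (2 * (a - a') * p) <= 2 * (a - a') * ((1 + b) * s).
  rewrite -mulrN; apply: ler_wpM2l; first by rewrite mulr_ge0// subr_ge0.
  by move: d0 hz; rewrite -/s; lra.
have q12 : q1 + q2 <= 2 * ((1 + b) ^+ 2 * s).
  have : 0 <= b * s by rewrite mulr_ge0.
  have : 0 <= b * (b * s) by rewrite !mulr_ge0.
  by move: d1 d2 hz hw hMw; rewrite -/s; lra.
have q3s : q3 <= (1 + b) ^+ 2 * s.
  have : 0 <= b * s by rewrite mulr_ge0.
  by move: d3 hw hMw; lra.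
have cs0 : 0 <= (1 + b) ^+ 2 * s by rewrite mulr_ge0// sqr_ge0.
have e3 : 2 * a' * (a * (q1 + q2)) <= 2 * a ^+ 2 * (2 * ((1 + b) ^+ 2 * s)).
  apply: (@le_trans _ _ (2 * a' * (a * (2 * ((1 + b) ^+ 2 * s))))).
    by rewrite ler_wpM2l ?mulr_ge0// ler_wpM2l.
  apply: (@le_trans _ _ (2 * a * (a * (2 * ((1 + b) ^+ 2 * s))))).
    by apply: ler_wpM2r; [rewrite !mulr_ge0// ?sqr_ge0 ?exprn_ge0 ?addr_ge0|rewrite ler_wpM2l].
  by rewrite le_eqVlt; apply/orP; left; apply/eqP; ring.
have e4 : 2 * a' * (a * (a * q3)) <= 2 * a ^+ 2 * (a0 * ((1 + b) ^+ 2 * s)).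
  apply: (@le_trans _ _ (2 * a' * (a * (a * ((1 + b) ^+ 2 * s))))).
    by rewrite ler_wpM2l ?mulr_ge0// ler_wpM2l// ler_wpM2l.
  apply: (@le_trans _ _ (2 * a0 * (a * (a * ((1 + b) ^+ 2 * s))))).
    apply: ler_wpM2r; first by rewrite !mulr_ge0// ?sqr_ge0 ?exprn_ge0 ?addr_ge0.
    by rewrite ler_wpM2l// (le_trans a'a).
  by rewrite le_eqVlt; apply/orP; left; apply/eqP; ring.
have e5 : 0 <= a ^+ 2 * ((1 + b) * s) by rewrite !mulr_ge0// ?sqr_ge0// addr_ge0.
have e6 : 0 <= (a - a') * (b * s) by rewrite !mulr_ge0// subr_ge0.
have e7 : 0 <= (a - a') * ((2 + a0) * ((1 + b) ^+ 2 * s)).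
  by rewrite mulr_ge0 ?subr_ge0// mulr_ge0// addr_ge0.
move: e1 e2 e3 e4 e5 e6 e7.
lra.
Qed.

End vectors.

(** Monotone convergence: the sum of the series has finite expectation, hence is almost surely
    finite. *)
Lemma summable_ae (R : realType) d (Omega : measurableType d)
    (P : probability Omega R) (F : nat -> Omega -> R) :
  (forall t, bmeas (F t)) -> (forall t om, 0 <= F t om) ->
  cvgn (series (fun t => \int[P]_om F t om)) ->
  {ae P, forall om, cvgn (series (F ^~ om))}.
Proof.
move=> bF F0 cF; have P1 := probability_setT P.
have mF t : measurable_fun setT (fun om => (F t om)%:E).
  by apply/measurable_EFinP; case: (bF t).
have F0' t om : setT om -> (0 <= (F t om)%:E)%E by rewrite lee_fin.
have I0 t : 0 <= \int[P]_om F t om by exact: Rintegral_ge0.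
pose g om := (\sum_(t <oo) (F t om)%:E)%E.
have mg : measurable_fun setT g by apply: ge0_emeasurable_sum => // k om _ _; exact: F0'.
have g0 om : (0 <= g om)%E by apply: nneseries_ge0 => t _ _; exact: F0'.
have ig : P.-integrable setT g.
  apply/integrableP; split => //.
  under eq_integral do rewrite gee0_abs//.
  rewrite integral_nneseries//.
  rewrite (eq_eseriesr (g := fun t => (\int[P]_om F t om)%:E)); last first.
    by move=> t _; rewrite EFin_Rintegral.
  apply: (@le_lt_trans _ _ (limn (series (fun t => \int[P]_om F t om)))%:E); last exact: ltry.
  apply: lime_le; first by apply: is_cvg_nneseries => n _ _; rewrite lee_fin.
  apply: nearW => n; rewrite sumEFin lee_fin.
  exact: series_le_lim.
have := integrable_ae measurableT ig; apply: filterS => om /(_ Logic.I) gf.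
apply: (ge0_cvg_series (M := fine (g om))) => // n.
rewrite -lee_fin fineK// /series/= -sumEFin.
by apply: nneseries_lim_ge => k *; exact: F0'.
Qed.

(** * Linear stochastic approximation with Markovian noise *)

Section bounded_measurable_matrices.
Context (R : realType) (d : measure_display) (T : measurableType d).

Definition bmx (m n : nat) (f : T -> 'M[R]_(m, n)) :=
  forall i j, bmeas (fun t => f t i j).

Lemma bmx_cst m n (A : 'M[R]_(m, n)) : bmx (fun=> A).
Proof. by move=> i j; exact: bmeas_cst. Qed.

Lemma bmxD m n (f g : T -> 'M[R]_(m, n)) :
  bmx f -> bmx g -> bmx (fun t => f t + g t).
Proof.
move=> bf bg i j; have := bmeasD (bf i j) (bg i j).
by congr bmeas; apply/funext => t; rewrite mxE.
Qed.

Lemma bmxZ m n (a : R) (f : T -> 'M[R]_(m, n)) : bmx f -> bmx (fun t => a *: f t).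
Proof.
move=> bf i j; have := bmeasM (bmeas_cst _ a) (bf i j).
by congr bmeas; apply/funext => t; rewrite mxE.
Qed.

Lemma bmxB m n (f g : T -> 'M[R]_(m, n)) :
  bmx f -> bmx g -> bmx (fun t => f t - g t).
Proof.
move=> bf bg i j; have := bmeasB (bf i j) (bg i j).
by congr bmeas; apply/funext => t; rewrite !mxE.
Qed.

Lemma bmxM m n k (f : T -> 'M[R]_(m, n)) (g : T -> 'M[R]_(n, k)) :
  bmx f -> bmx g -> bmx (fun t => f t *m g t).
Proof.
move=> bf bg i j.
have := bmeas_sum (index_enum 'I_n) (fun l => bmeasM (bf i l) (bg l j)).
by congr bmeas; apply/funext => t; rewrite mxE.
Qed.

Lemma bmx_tr m n (f : T -> 'M[R]_(m, n)) : bmx f -> bmx (fun t => (f t)^T).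
Proof.
by move=> bf i j; have := bf j i; congr bmeas; apply/funext => t; rewrite mxE.
Qed.

Lemma bmeas_dotp n (u v : T -> 'cV[R]_n) :
  bmx u -> bmx v -> bmeas (fun t => dotp (u t) (v t)).
Proof.
by move=> bu bv; apply: bmeas_sum => i; exact: bmeasM (bu i 0) (bv i 0).
Qed.

Lemma bmx_bound m n (f : T -> 'M[R]_(m, n)) : bmx f ->
  exists2 K, 0 <= K & forall t i j, `|f t i j| <= K.
Proof.
move=> bf; pose C i j := projT1 (cid (proj2 (bf i j))).
have fC t i j : `|f t i j| <= C i j by rewrite /C; case: cid.
have C0 i j : 0 <= C i j by exact: le_trans (fC point i j).
exists (\sum_i \sum_j C i j) => [|t i j]; first by do 2 apply: sumr_ge0 => ? _.
apply: le_trans (fC t i j) _; rewrite (bigD1 i)//= (bigD1 j)//= -addrA lerDl.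
by rewrite addr_ge0//; repeat (apply: sumr_ge0 => ? _).
Qed.

End bounded_measurable_matrices.

Section linear_iteration.
Context (R : realType) (n : nat).

Fixpoint lin_iter (alpha : nat -> R) (B : nat -> 'M[R]_n) (z0 : 'cV[R]_n) t :=
  if t is t'.+1 then
    let z := lin_iter alpha B z0 t' in z + alpha t' *: (B t' *m z)
  else z0.

Lemma dotp_mulmx (M : 'M[R]_n) (u v : 'cV[R]_n) :
  dotp u (M *m v) = \sum_i \sum_j (u i 0 * v j 0) * M i j.
Proof.
apply: eq_bigr => i _; rewrite mxE mulr_sumr; apply: eq_bigr => j _.
by rewrite -mulrA (mulrC (v j 0)).
Qed.

End linear_iteration.

Section kernel_mean.
Context (R : realType) (dX : measure_display) (X : measurableType dX).
Variables (p : R.-pker X ~> X) (m n : nat) (N : X * X -> 'M[R]_(m, n)).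

Definition kernel_mean (s : X) : 'M[R]_(m, n) :=
  \matrix_(i, j) \int[p s]_b N (s, b) i j.

Lemma bmx_kernel_mean : bmx N -> bmx kernel_mean.
Proof.
move=> bN i j; have := bmeas_kernel_integral p (bN i j).
by congr bmeas; apply/funext => s; rewrite mxE.
Qed.

End kernel_mean.

(** * Conditioning a Markov chain on its past *)

Section markov_linear_iteration.
Context (R : realType) (dO dX : measure_display).
Context (Omega : measurableType dO) (X : measurableType dX).
Context (P : probability Omega R) (p : R.-pker X ~> X).
Variable S_ : nat -> {RV P >-> X}.
Hypothesis chain : markov_chain p S_.

(** Generators of the natural filtration, written so that the generated sigma-algebra is the one
    occurring in [markov_chain]. *)
Definition past (t : nat) : set (set Omega) :=
  \big[setU/set0]_(i < t.+1) preimage_set_system setT (S_ i : Omega -> X) measurable.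

Lemma past_measurable t : past t `<=` measurable.
Proof.
rewrite /past; elim: t.+1 => [|k ih]; first by rewrite big_ord0.
rewrite big_ord_recr subUset; split => // _ [A mA <-].
by apply: measurable_funP.
Qed.

Lemma past_succ t : past t `<=` <<s past t.+1 >>.
Proof.
move=> A pA; apply: sub_sigma_algebra; rewrite /past big_ord_recr; by left.
Qed.

Lemma past_chain t :
  measurable_fun setT (S_ t : g_sigma_algebraType (past t) -> X).
Proof.
move=> _ A mA; apply: sub_sigma_algebra; rewrite /past big_ord_recr/=; right.
by exists A.
Qed.

Local Notation adapted := (adapted past).

Lemma adapted_pair t (f : X * X -> R) : bmeas f ->
  adapted t.+1 (fun om => f (S_ t om, S_ t.+1 om)).
Proof.
apply: (@bmeas_comp _ _ _ _ (g_sigma_algebraType (past t.+1))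
  (fun om => (S_ t om, S_ t.+1 om))).
apply: measurable_fun_pair; last exact: past_chain.
move=> mT A mA; apply: sub_sigma_algebra.
by rewrite /past big_ord_recr big_ord_recr/=; left; right; exists A.
Qed.

Lemma adapted_chain t (f : X -> R) : bmeas f -> adapted t (fun om => f (S_ t om)).
Proof. by apply: bmeas_comp; exact: past_chain. Qed.

(** [freezing] is applied with [U] the identity from the sample space to the same space carrying
    only the past, and [V] the next state. Then [Phi] and [S_ t] are functions of [U], and the
    hypothesis relating [U] to [V] is the Markov property itself. *)
Lemma chain_freezing t (Phi : Omega -> R) (f : X * X -> R) :
  adapted t Phi -> bmeas f ->
  \int[P]_om (Phi om * f (S_ t om, S_ t.+1 om)) =
  \int[P]_om (Phi om * \int[p (S_ t om)]_b f (S_ t om, b)).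
Proof.
move=> aPhi bf.
pose T := g_sigma_algebraType (past t).
have mS : measurable_fun setT (S_ t : T -> X) := past_chain (t := t).
have mid : measurable_fun setT (id : Omega -> T).
  move=> _ A mA; rewrite setTI preimage_id.
  by apply: (smallest_sub _ (@past_measurable t)) A mA; exact: sigma_algebra_measurable.
pose F (y : T * X) := Phi y.1 * f (S_ t y.1, y.2).
have bF : bmeas F.
  apply: bmeasM; first exact: (@bmeas_comp _ _ _ T (T * X)%type fst).
  apply: (@bmeas_comp _ _ _ _ (T * X)%type (fun y : T * X => (S_ t y.1, y.2))) => //.
  apply: measurable_fun_pair => //.
  exact: (@measurableT_comp _ _ _ _ _ _ (S_ t : T -> X)).
have := @freezing _ _ _ T X (kpull p mS) _ Omega P id (S_ t.+1) mid _ _ F bF.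
rewrite /F /= => ->//.
- apply: eq_Rintegral => om _; rewrite bintegralZ//; first exact: prob_kernel.
  exact: bmeas_section.
- by move=> A B mA mB; rewrite preimage_id; apply: chain.
Qed.

Variables (n : nat) (N : X * X -> 'M[R]_n).
Hypothesis bN : bmx N.

Local Notation M := (kernel_mean p N).

(** The bilinear form is expanded into entries of [N] with weights known at time t. Taking both
    vectors equal to z_t gives the energy balance; a multiple of a unit vector on the left gives the
    martingale property. *)
Lemma dotp_freezing t (u v : Omega -> 'cV[R]_n) :
  (forall i, adapted t (fun om => u om i 0)) ->
  (forall i, adapted t (fun om => v om i 0)) ->
  \int[P]_om dotp (u om) (N (S_ t om, S_ t.+1 om) *m v om) =
  \int[P]_om dotp (u om) (M (S_ t om) *m v om).
Proof.
move=> au av; have P1 := probability_setT P.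
have auv i j : adapted t (fun om => u om i 0 * v om j 0).
  exact: bmeasM (au i) (av j).
under eq_Rintegral do rewrite dotp_mulmx.
under [RHS]eq_Rintegral do rewrite dotp_mulmx.
have b1 i j := adapted_bmeas past_measurable (auv i j).
have b2 i j := adapted_bmeas past_measurable (adapted_pair t (bN i j)).
have b3 i j := adapted_bmeas past_measurable (adapted_chain t (bmx_kernel_mean p bN i j)).
rewrite (bintegral_sum P1 _ (F := fun i om => \sum_j (u om i 0 * v om j 0) *
  N (S_ t om, S_ t.+1 om) i j)); last first.
  by move=> i; apply: bmeas_sum => j; exact: bmeasM.
rewrite (bintegral_sum P1 _ (F := fun i om => \sum_j (u om i 0 * v om j 0) *
  M (S_ t om) i j)); last first.
  by move=> i; apply: bmeas_sum => j; exact: bmeasM.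
apply: eq_bigr => i _.
rewrite (bintegral_sum P1 _ (F := fun j om => (u om i 0 * v om j 0) *
  N (S_ t om, S_ t.+1 om) i j)); last by move=> j; exact: bmeasM.
rewrite (bintegral_sum P1 _ (F := fun j om => (u om i 0 * v om j 0) *
  M (S_ t om) i j)); last by move=> j; exact: bmeasM.
apply: eq_bigr => j _.
rewrite (chain_freezing (auv i j) (bN i j)).
by apply: eq_Rintegral => om _; rewrite mxE.
Qed.

End markov_linear_iteration.

Section linear_stochastic_approximation.
Context (R : realType) (dO dX : measure_display).
Context (Omega : measurableType dO) (X : measurableType dX).
Context (P : probability Omega R) (p : R.-pker X ~> X).
Variable S_ : nat -> {RV P >-> X}.
Hypothesis chain : markov_chain p S_.
Variables (n : nat) (N : X * X -> 'M[R]_n).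
Hypothesis bN : bmx N.
Variables (A G L : 'M[R]_n) (c : R).
Hypotheses (c0 : 0 < c) (AGL : A = G *m L).
Hypothesis dissipative : forall v, dotp v (A *m v) <= - c * sqn (L *m v).
Variable alpha : nat -> R.
Hypotheses (alpha0 : forall t, 0 < alpha t) (alpha_dec : nonincreasing_seq alpha).
Hypothesis alpha_oo : series alpha @ \oo --> +oo.
Hypothesis alpha2 : cvgn (series (fun t => alpha t ^+ 2)).
Variable z0 : 'cV[R]_n.

Local Notation M := (kernel_mean p N).

Let Nt t om := N (S_ t om, S_ t.+1 om).
Let Mt t om := M (S_ t om).
Let B om t := A + Nt t om - Mt t.+1 om.
Let z t om := lin_iter alpha (B om) z0 t.
Let eps t := alpha t ^+ 2 + (alpha t - alpha t.+1).

Let P1 : P setT = 1%E. Proof. exact: probability_setT. Qed.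

Let alpha_cvg : alpha @ \oo --> 0.
Proof.
apply/cvgrPdist_lt => e e0.
have /cvgrPdist_lt/(_ _ (exprn_gt0 2 e0)) [T _ HT] := cvg_series_cvg_0 alpha2.
exists T => // t /HT /=; rewrite !sub0r !normrN normrX.
by rewrite ltr_sqr ?nnegrE// ltW.
Qed.

Let alpha_step t : alpha t.+1 <= alpha t.
Proof. by apply: alpha_dec. Qed.

Let alpha_le0 t : alpha t <= alpha 0%N.
Proof. by apply: alpha_dec. Qed.

Let eps0 t : 0 <= eps t.
Proof. by rewrite addr_ge0 ?sqr_ge0// subr_ge0. Qed.

(** The decrements of [alpha] telescope to at most [alpha 0]. *)
Let eps_cvg : cvgn (series eps).
Proof.
apply: (ge0_cvg_series (M := limn (series (fun t => alpha t ^+ 2)) + alpha 0%N)) => //.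
move=> k; have -> : series eps k =
    series (fun t => alpha t ^+ 2) k + (alpha 0%N - alpha k).
  elim: k => [|k ih]; first by rewrite /series/= !big_geq// subrr addr0.
  by rewrite !seriesSr ih /eps; ring.
apply: lerD; first by apply: series_le_lim => // t; exact: sqr_ge0.
by rewrite lerBlDr lerDl ltW.
Qed.

Let bM : bmx M := bmx_kernel_mean p bN.

Let am_pair t : bmx (Nt t : g_sigma_algebraType (past S_ t.+1) -> _).
Proof. by move=> i j; exact: (adapted_pair S_ t (bN i j)). Qed.

Let am_chain t : bmx (Mt t : g_sigma_algebraType (past S_ t) -> _).
Proof. by move=> i j; exact: (adapted_chain S_ t (bM i j)). Qed.

Let amS t m k (f : Omega -> 'M[R]_(m, k)) :
  bmx (f : g_sigma_algebraType (past S_ t) -> _) ->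
  bmx (f : g_sigma_algebraType (past S_ t.+1) -> _).
Proof. by move=> af i j; exact: (adaptedS (@past_succ _ _ _ _ _ _ S_) (af i j)). Qed.

Let am_bmx t m k (f : Omega -> 'M[R]_(m, k)) :
  bmx (f : g_sigma_algebraType (past S_ t) -> _) -> bmx f.
Proof.
by move=> af i j; exact: (adapted_bmeas (@past_measurable _ _ _ _ _ _ S_)) (af i j).
Qed.

Let am_B t : bmx ((fun om => B om t) : g_sigma_algebraType (past S_ t.+1) -> _).
Proof.
apply: bmxB; last exact: am_chain.
by apply: bmxD; [exact: bmx_cst|exact: am_pair].
Qed.

Let am_z t : bmx (z t : g_sigma_algebraType (past S_ t) -> _).
Proof.
elim: t => [|t ih]; first exact: bmx_cst.
apply: bmxD; first exact: amS.
by apply: bmxZ; apply: bmxM; [exact: am_B|exact: amS].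
Qed.

Let bz t : bmx (z t) := am_bmx (am_z t).
Let bNt t : bmx (Nt t) := am_bmx (am_pair t).
Let bMt t : bmx (Mt t) := am_bmx (am_chain t).

(** One squared operator bound for all the random matrices, uniform in sample point and time; it
    need not be below 1. *)
Let contraction_bound : exists2 b, 0 <= b &
  [/\ forall s v, sqn (M s *m v) <= b * sqn v,
      forall om t v, sqn (B om t *m v) <= b * sqn v &
      forall om t v, sqn ((Nt t om - Mt t om) *m v) <= b * sqn v].
Proof.
have [KN KN0 NK] := bmx_bound bN.
have [KM KM0 MK] := bmx_bound bM.
have [KA KA0 AK] := bmx_bound (bmx_cst Omega A).
pose K := KA + KN + KM; pose b := n%:R * (2 * n%:R * K ^+ 2).
exists b; first by rewrite !mulr_ge0 ?addr_ge0.
split=> [s v|om t v|om t v]; apply: sqn_bounded_mulmx (lexx b) => i j.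
- by rewrite (le_trans (MK _ _ _))// lerDr addr_ge0.
- rewrite !mxE (le_trans (ler_normB _ _))// lerD//; last first.
    by have := MK (S_ t.+1 om) i j; rewrite mxE.
  by apply: le_trans (ler_normD _ _) _; apply: lerD; [exact: AK om i j|exact: NK].
- rewrite !mxE (le_trans (ler_normB _ _))// lerD//; last first.
    by have := MK (S_ t om) i j; rewrite mxE.
  by rewrite (le_trans (NK _ _ _))// lerDr.
Qed.

Let b := s2val (cid2 contraction_bound).
Let b0 : 0 <= b. Proof. exact: s2valP (cid2 contraction_bound). Qed.
Let hM s v : sqn (M s *m v) <= b * sqn v.
Proof. by have [] := s2valP' (cid2 contraction_bound). Qed.
Let hB om t v : sqn (B om t *m v) <= b * sqn v.
Proof. by have [] := s2valP' (cid2 contraction_bound). Qed.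
Let hNM om t v : sqn ((Nt t om - Mt t om) *m v) <= b * sqn v.
Proof. by have [] := s2valP' (cid2 contraction_bound). Qed.

Let V t := \int[P]_om sqn (z t om).
Let kap t := \int[P]_om sqn (L *m z t om).
(** The constant of [lyapunov_step], with the first and largest step size in the place of [a0]. *)
Let C := b + 2 * (1 + b) + 2 * (2 + alpha 0%N) * (1 + b) ^+ 2.

Let b_sqn t : bmeas (fun om => sqn (z t om)).
Proof. exact: bmeas_dotp. Qed.

Let bL t : bmx (fun om => L *m z t om).
Proof. by apply: bmxM => //; exact: bmx_cst. Qed.

Let moments : (exists Mx, forall t, V t <= Mx) /\
  cvgn (series (fun t => alpha t * kap t)).
Proof.
pose U t := V t + 2 * alpha t * \int[P]_om dotp (z t om) (Mt t om *m z t om).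
have bzMz t : bmeas (fun om => dotp (z t om) (Mt t om *m z t om)).
  by apply: bmeas_dotp => //; exact: bmxM.
have bzNz t : bmeas (fun om => dotp (z t om) (Nt t om *m z t om)).
  by apply: bmeas_dotp => //; exact: bmxM.
have bzAz t : bmeas (fun om => dotp (z t om) (A *m z t om)).
  by apply: bmeas_dotp => //; apply: bmxM => //; exact: bmx_cst.
have C0 : 0 <= C.
  rewrite /C; apply: addr_ge0; first by rewrite !addr_ge0// mulr_ge0// addr_ge0.
  by rewrite !mulr_ge0 ?sqr_ge0 ?addr_ge0// ltW.
apply: (@lyapunov_bound _ alpha eps U V kap C (2 * c)) => //.
- by rewrite mulr_gt0.
- by move=> t; apply: Rintegral_ge0 => om _; exact: sqn_ge0.
- by move=> t; apply: Rintegral_ge0 => om _; exact: sqn_ge0.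
(* Since |z^T M z| <= |z|^2 + |M z|^2, the correction in [U t] is at least -2 alpha_t (1 + b) V_t,
   and C >= 2(1 + b). *)
- move=> t; rewrite /U.
  have h : - ((1 + b) * V t) <= \int[P]_om dotp (z t om) (Mt t om *m z t om).
    rewrite -mulNr -bintegralZ//; apply: ler_bintegral => //.
      exact: bmeasM (bmeas_cst _ _) (b_sqn t).
    move=> om; have := ler_norm_dotp (z t om) (Mt t om *m z t om).
    rewrite ler_norml => /andP[+ _]; have := hM (S_ t om) (z t om).
    rewrite -/(Mt t om); lra.
  have V0 : 0 <= V t by apply: Rintegral_ge0 => om _; exact: sqn_ge0.
  have := ler_wpM2l (ltW (alpha0 t)) h.
  have : 2 * (1 + b) * (alpha t * V t) <= C * (alpha t * V t).
    rewrite ler_wpM2r ?mulr_ge0 ?(ltW (alpha0 t))// /C.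
    have : 0 <= 2 * (2 + alpha 0%N) * (1 + b) ^+ 2.
      by rewrite !mulr_ge0 ?sqr_ge0 ?addr_ge0// ltW.
    by have := b0; lra.
  lra.
- move=> t; rewrite {1}/U.
  (* In expectation, the term z^T N(Y_t) z left by [lyapunov_step] becomes z^T M(S_t) z, which is
     exactly the correction contained in [U t]. *)
  have := @dotp_freezing _ _ _ _ _ _ _ _ chain _ _ bN t (z t) (z t)
    (fun i => am_z t i 0) (fun i => am_z t i 0).
  rewrite -/(Nt t) -/(Mt t) => fr.
  have bS := bmeasM (bmeas_cst Omega (2 * alpha t.+1)) (bzMz t.+1).
  rewrite /V -bintegralZ// -bintegralD//.
  have bl := bmeasM (bmeas_cst Omega (2 * alpha t)) (bzAz t).
  have bm := bmeasM (bmeas_cst Omega (2 * alpha t)) (bzNz t).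
  have bn := bmeasM (bmeas_cst Omega (C * eps t)) (b_sqn t).
  have bo := bmeasD (bmeasD (bmeasD (b_sqn t) bl) bm) bn.
  apply: (@le_trans _ _ (\int[P]_om (sqn (z t om) +
    2 * alpha t * dotp (z t om) (A *m z t om) +
    2 * alpha t * dotp (z t om) (Nt t om *m z t om) +
    C * eps t * sqn (z t om)))).
    apply: ler_bintegral => //; first exact: bmeasD.
    move=> om; apply: (@lyapunov_step _ _ _ _ _ _ b _ _ (alpha 0%N)) => //.
    + exact: ltW.
    + exact: hM.
    + exact: hB.
  rewrite bintegralD//; last exact: bmeasD (bmeasD (b_sqn t) bl) bm.
  rewrite bintegralD//; last exact: bmeasD (b_sqn t) bl.
  rewrite bintegralD// !bintegralZ// fr /U -/(V t).
  have : \int[P]_om dotp (z t om) (A *m z t om) <= - c * kap t.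
    rewrite -bintegralZ//; last exact: bmeas_dotp.
    apply: ler_bintegral => //.
    exact: bmeasM (bmeas_cst _ _) (bmeas_dotp (bL t) (bL t)).
  move=> /(ler_wpM2l (ltW (alpha0 t))); lra.
Qed.

Let V_bound : exists Mx, forall t, V t <= Mx. Proof. by case: moments. Qed.

(** The substitute for almost sure boundedness of the iterates, obtained from the uniform second
    moment. *)
Let summable_sqn (a : nat -> R) : (forall t, 0 <= a t) -> cvgn (series a) ->
  {ae P, forall om, cvgn (series (fun t => a t * (1 + sqn (z t om))))}.
Proof.
move=> a0 ca; have [Mx VM] := V_bound.
have b1 t : bmeas (fun om => 1 + sqn (z t om)).
  exact: bmeasD (bmeas_cst _ _) (b_sqn t).
apply: summable_ae => [t|t om|].
- exact: bmeasM (bmeas_cst _ _) (b1 t).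
- by rewrite mulr_ge0// addr_ge0// sqn_ge0.
apply: (@ge0_le_cvg_series _ _ (fun t => (1 + Mx) * a t)) => [t|t|].
- by apply: Rintegral_ge0 => om _; rewrite mulr_ge0// addr_ge0// sqn_ge0.
- rewrite bintegralZ// mulrC ler_wpM2r// bintegralD//; last exact: bmeas_cst.
  by rewrite bintegral_cst// lerD2l; exact: VM.
- exact: cvg_seriesZ.
Qed.

Let D i t om := alpha t * ((Nt t om - Mt t om) *m z t om) i 0.

Let D_cvg i : {ae P, forall om, cvgn (series (fun t => D i t om))}.
Proof.
have aD t : adapted (past S_) t.+1 (D i t).
  apply: bmeasM; first exact: bmeas_cst.
  by apply: bmxM; [apply: bmxB; [exact: am_pair|exact: amS]|exact: amS].
have bD t : bmeas (D i t).
  exact: (adapted_bmeas (@past_measurable _ _ _ _ _ _ S_) (aD t)).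
apply: (@L2_martingale_cvg _ _ _ P (past S_) (@past_measurable _ _ _ _ _ _ S_)
  (@past_succ _ _ _ _ _ _ S_) (D i)) => //.
- move=> t f af.
  (* With u = f e_i, pairing with [u] extracts the i-th coordinate multiplied by the test variable
     [f]. *)
  pose u om : 'cV[R]_n := f om *: delta_mx i 0.
  have dotpu om w : dotp (u om) w = f om * w i 0.
    rewrite dotpZl /dotp (bigD1 i)//= big1 ?addr0; last first.
      by move=> j ji; rewrite mxE (negbTE ji) mul0r.
    by rewrite mxE !eqxx mul1r.
  have au : bmx (u : g_sigma_algebraType (past S_ t) -> _).
    move=> j k; have := bmeasM af (bmeas_cst _ (delta_mx i 0 j k : R)).
    by congr bmeas; apply/funext => om; rewrite !mxE.
  have bu := am_bmx au.
  have := @dotp_freezing _ _ _ _ _ _ _ _ chain _ _ bN t u (z t)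
    (fun i => au i 0) (fun i => am_z t i 0).
  rewrite -/(Nt t) -/(Mt t) => fr.
  have bN' : bmeas (fun om => dotp (u om) (Nt t om *m z t om)).
    by apply: bmeas_dotp => //; exact: bmxM.
  have bM' : bmeas (fun om => dotp (u om) (Mt t om *m z t om)).
    by apply: bmeas_dotp => //; exact: bmxM.
  rewrite (_ : Rintegral _ _ _ = \int[P]_om (alpha t *
      (dotp (u om) (Nt t om *m z t om) - dotp (u om) (Mt t om *m z t om)))); last first.
    apply: eq_Rintegral => om _; rewrite !dotpu /D mulmxBl !mxE; ring.
  rewrite bintegralZ//; last exact: bmeasB.
  by rewrite bintegralB// fr subrr mulr0.
have [Mx VM] := V_bound.
(* E D_t^2 <= alpha_t^2 b E |z_t|^2: the uniform second moment makes the martingale bounded in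
   L2. *)
apply: (@ge0_le_cvg_series _ _ (fun t => (b * Mx) * alpha t ^+ 2)) => [t|t|].
- by apply: Rintegral_ge0 => om _; exact: sqr_ge0.
- apply: (@le_trans _ _ (\int[P]_om (alpha t ^+ 2 * b * sqn (z t om)))).
    apply: ler_bintegral => //.
    + exact: bmeasX.
    + exact: bmeasM (bmeas_cst _ _) (b_sqn t).
    move=> om; rewrite /D exprMn -mulrA ler_wpM2l ?sqr_ge0//.
    exact: le_trans (le_sqn _ i) (hNM _ _ _).
  rewrite bintegralZ// -/(V t).
  by have := ler_wpM2l (mulr_ge0 (sqr_ge0 (alpha t)) b0) (VM t); lra.
- exact: cvg_seriesZ.
Qed.

(** The remainder of a summation by parts: alpha_t (M(S_t) - M(S_{t+1})) z_t is the decrement from t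
    to t + 1 of alpha_t M(S_t) z_t, plus this vector. *)
Let F i t om := (Mt t.+1 om *m (alpha t.+1 *: z t.+1 om - alpha t *: z t om)) i 0.

(** Inserting z_{t+1} = z_t + alpha_t B z_t leaves one term with factor alpha_{t+1} alpha_t <=
    alpha_t^2 and one with factor alpha_t - alpha_{t+1}. The estimate |x| <= 1 + x^2 makes both
    quadratic in z_t. *)
Let F_le i t om : `|F i t om| <= (2 + b * b + b) * (eps t * (1 + sqn (z t om))).
Proof.
have E : F i t om = alpha t.+1 * alpha t * (Mt t.+1 om *m (B om t *m z t om)) i 0 -
    (alpha t - alpha t.+1) * (Mt t.+1 om *m z t om) i 0.
  rewrite /F /=; set w := Mt _ _ *m (_ *m _).
  by rewrite mulmxBr -!scalemxAr mulmxDr -scalemxAr -/w !mxE; ring.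
set s := sqn (z t om).
have s0 : 0 <= s := sqn_ge0 _.
have h1 := le_trans (le_sqn _ i) (hM (S_ t.+1 om) (B om t *m z t om)).
have h2 := le_trans (le_sqn _ i) (hM (S_ t.+1 om) (z t om)).
have h3 : b * sqn (B om t *m z t om) <= b * (b * s) by rewrite ler_wpM2l.
have norm_le (x y : R) : x ^+ 2 <= y -> `|x| <= 1 + y.
  rewrite -real_normK ?num_real//; have := sqr_ge0 (`|x| - 1); nra.
have {}h1 := norm_le _ _ (le_trans h1 h3).
have {}h2 := norm_le _ _ h2.
have al := ltW (alpha0 t).
have d0 : 0 <= alpha t - alpha t.+1 by rewrite subr_ge0.
have aa : alpha t.+1 * alpha t <= alpha t ^+ 2 by rewrite expr2 ler_wpM2r.
rewrite E (le_trans (ler_normB _ _))// !normrM.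
rewrite (ger0_norm (ltW (alpha0 t.+1))) (ger0_norm al) (ger0_norm d0).
have b2s : 0 <= b * (b * s) by rewrite !mulr_ge0.
have bs : 0 <= b * s by rewrite !mulr_ge0.
apply: (@le_trans _ _ (alpha t ^+ 2 * (1 + b * (b * s)) +
    (alpha t - alpha t.+1) * (1 + b * s))).
  apply: lerD; last by rewrite ler_wpM2l.
  by apply: ler_pM => //; rewrite mulr_ge0// ltW.
have k1 : 0 <= alpha t ^+ 2 * (1 + b * s + 2 * s + b * b + b).
  by rewrite mulr_ge0 ?sqr_ge0// !addr_ge0// ?mulr_ge0.
have k2 : 0 <= (alpha t - alpha t.+1) * (1 + b * (b * s) + 2 * s + b * b + b).
  by rewrite mulr_ge0// !addr_ge0// ?mulr_ge0.
by rewrite /eps; move: k1 k2; lra.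
Qed.

Lemma lin_iter_cvg0 :
  {ae P, forall om i, (L *m lin_iter alpha (fun t => A + N (S_ t om, S_ t.+1 om)
     - kernel_mean p N (S_ t.+1 om)) z0 t) i 0 @[t --> \oo] --> 0}.
Proof.
have ae1 : {ae P, forall om, cvgn (series (fun t => alpha t * sqn (L *m z t om)))}.
  apply: summable_ae => [t|t om|].
  - exact: bmeasM (bmeas_cst _ _) (bmeas_dotp (bL t) (bL t)).
  - by rewrite mulr_ge0 ?sqn_ge0// ltW.
  rewrite (_ : (fun t => _) = fun t => alpha t * kap t); first by case: moments.
  by apply/funext => t; rewrite bintegralZ//; exact: bmeas_dotp.
have ae2 : {ae P, forall om, forall i, cvgn (series (fun t => D i t om))}.
  by apply: filter_forall => i; exact: D_cvg.
have ae3 := summable_sqn eps0 eps_cvg.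
have ae4 := summable_sqn (fun t => sqr_ge0 (alpha t)) alpha2.
have ae34 : {ae P, forall om,
    cvgn (series (fun t => eps t * (1 + sqn (z t om)))) /\
    cvgn (series (fun t => alpha t ^+ 2 * (1 + sqn (z t om))))}.
  by move: ae3 ae4; apply: filterS2.
move: ae1 ae2 ae34; apply: filterS3 => om c1 c2 [c3 c4].
have cF i : cvgn (series (fun t => F i t om)).
  apply: normed_cvg.
  apply: (@ge0_le_cvg_series _ _ (fun t => (2 + b * b + b) *
    (eps t * (1 + sqn (z t om))))) => [t|t|].
  - exact: normr_ge0.
  - exact: F_le.
  - exact: cvg_seriesZ.
pose W t := \col_i (series (fun t => D i t om) t + series (fun t => F i t om) t).
pose Winf := \col_i (limn (series (fun t => D i t om)) + limn (series (fun t => F i t om))).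
(* The vector z + alpha M z - W moves by the drift alone, since [W] collects the martingale and the
   remainders. Adding the constant [Winf] changes no increment and makes the deviation [r] from z
   tend to 0. *)
pose r t := alpha t *: (Mt t om *m z t om) + (Winf - W t).
pose y t := L *m (z t om + r t).
have r_cvg : norm1 (r t) @[t --> \oo] --> 0.
  rewrite [X in _ --> X](_ : _ = \sum_(i < n) `|0 : R|); last first.
    by rewrite normr0 big1.
  apply: cvg_big; [exact: add_continuous|move=> i _; apply: cvg_norm].
  (* Its square is at most b alpha_t^2 (1 + |z_t|^2), the general term of a convergent series. *)
  have h1 : alpha t * (Mt t om *m z t om) i 0 @[t --> \oo] --> 0.
    apply/cvgrPdist_lt => e e0.
    have /cvgrPdist_lt/(_ _ (exprn_gt0 2 e0)) [T _ HT] :=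
      cvg_series_cvg_0 (cvg_seriesZ (c := b) c4).
    exists T => // t /HT /=; rewrite !sub0r !normrN => ht.
    rewrite -(@ltr_sqr _ _ e) ?nnegrE// 1?ltW// real_normK ?num_real//.
    apply: le_lt_trans ht; apply: le_trans (ler_norm _).
    rewrite exprMn [leRHS]mulrCA ler_wpM2l ?sqr_ge0//.
    apply: le_trans (le_sqn _ i) _; apply: le_trans (hM _ _) _.
    by rewrite ler_wpM2l// lerDr.
  have h2 : limn (series (fun t => D i t om)) - series (fun t => D i t om) t
      @[t --> \oo] --> 0.
    by rewrite -(subrr (limn (series (fun t => D i t om)))); apply: cvgB => //; exact: cvg_cst.
  have h3 : limn (series (fun t => F i t om)) - series (fun t => F i t om) t
      @[t --> \oo] --> 0.
    by rewrite -(subrr (limn (series (fun t => F i t om)))); apply: cvgB => //; exact: cvg_cst.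
  have h : alpha t * (Mt t om *m z t om) i 0 +
     (limn (series (fun t => D i t om)) - series (fun t => D i t om) t) +
     (limn (series (fun t => F i t om)) - series (fun t => F i t om) t)
     @[t --> \oo] --> 0 + 0 + 0.
    by apply: cvgD => //; apply: cvgD.
  rewrite !addr0 in h.
  suff -> : (fun t => r t i 0) = (fun t => alpha t * (Mt t om *m z t om) i 0 +
     (limn (series (fun t => D i t om)) - series (fun t => D i t om) t) +
     (limn (series (fun t => F i t om)) - series (fun t => F i t om) t)) by [].
  by apply/funext => t; rewrite /r /Winf /W !mxE; ring.
have WS t : W t.+1 = W t + alpha t *: (Nt t om *m z t om - Mt t om *m z t om) +
    (alpha t.+1 *: (Mt t.+1 om *m z t.+1 om) - alpha t *: (Mt t.+1 om *m z t om)).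
  rewrite -mulmxBl !scalemxAr -mulmxBr; apply/colP => i.
  rewrite [LHS]mxE [RHS]mxE [X in _ = X + _]mxE -scalemxAr [X in _ + X + _]mxE.
  by rewrite [W t i 0]mxE !seriesSr -/(D i t om) -/(F i t om); ring.
(* Here A = G L is essential: L A z = (L G)(L z), so the increment of [y] depends on z only through
   L z, the quantity whose squares are summable against [alpha]. *)
have yS t : y t.+1 = y t + alpha t *: ((L *m G) *m (L *m z t om)).
  have zS : z t.+1 om = z t om + alpha t *: (A *m z t om + Nt t om *m z t om -
      Mt t.+1 om *m z t om) by rewrite -mulmxDl -mulmxBl.
  rewrite /y -!mulmxA (mulmxA G) -AGL scalemxAr -mulmxDr; congr (L *m _).
  rewrite /r WS; set z' := _ *m z t.+1 om; rewrite zS.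
  move: z' (A *m _) (Nt t om *m _) (Mt t om *m _) (Mt t.+1 om *m _) => z' p0 p1 p2 p3.
  by apply/colP => i; rewrite !mxE; ring.
pose K := \sum_i \sum_j `|(L *m G) i j|.
have K0 : 0 <= K by do 2 apply: sumr_ge0 => ? _.
pose KL := \sum_i \sum_j `|L i j|.
have rho_cvg : norm1 (L *m z t om) @[t --> \oo] --> 0.
  (* rho = |L z| and sig = |y| in the l1 norm; they differ by at most |L r| <= [KL] |r|. *)
  apply: (@cvg0_of_summable _ alpha _ (fun t => norm1 (y t)) K) => // [t||t|].
  - exact: norm1_ge0.
  - apply: (@ge0_le_cvg_series _ _ (fun t => 2 * n%:R * (alpha t * sqn (L *m z t om)))) => [t|t|].
    + by rewrite mulr_ge0 ?sqr_ge0// ltW.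
    + by rewrite [leRHS]mulrCA ler_wpM2l ?norm1_sqr// ltW.
    + exact: cvg_seriesZ.
  - rewrite yS (le_trans (norm1D _ _))// lerD2l norm1Z (ger0_norm (ltW (alpha0 t))).
    by rewrite (mulrC K) -mulrA ler_wpM2l ?norm1_mulmx// ltW.
  have KLr : KL * norm1 (r t) @[t --> \oo] --> 0 by rewrite -(mulr0 KL); exact: cvgMr.
  apply/cvgrPdist_lt => e e0; move/cvgrPdist_lt : KLr => /(_ e e0) [T _ HT].
  exists T => // t /HT; rewrite /= !sub0r !normrN; apply: le_lt_trans.
  apply: le_trans (ler_norm _).
  have h1 : norm1 (y t) <= norm1 (L *m z t om) + norm1 (L *m r t).
    by rewrite /y mulmxDr norm1D.
  have h2 : norm1 (L *m z t om) <= norm1 (y t) + norm1 (L *m r t).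
    rewrite -[X in X <= _]/(norm1 _) -{1}(addrK (r t) (z t om)) mulmxBr.
    by rewrite -/(y t) (le_trans (norm1D _ _))// lerD2l -scaleN1r norm1Z normrN1 mul1r.
  have h3 : norm1 (L *m r t) <= KL * norm1 (r t) by exact: norm1_mulmx.
  by rewrite ler_norml; apply/andP; split; lra.
move=> i; apply/cvgrPdist_lt => e e0; move/cvgrPdist_lt : rho_cvg => /(_ e e0) [T _ HT].
exists T => // t /HT; rewrite /= !sub0r !normrN; apply: le_lt_trans.
apply: le_trans (ler_norm _).
by rewrite /norm1 (bigD1 i)//= lerDl sumr_ge0.
Qed.

End linear_stochastic_approximation.

Lemma bintegral_transfer (R : realType) d d' (T : measurableType d)
    (T' : measurableType d') (m : {measure set T -> \bar R})
    (m' : {measure set T' -> \bar R}) (phi : T -> T') (f : T' -> R) :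
  m setT = 1%E -> measurable_fun setT phi ->
  (forall B, measurable B -> m' B = m (phi @^-1` B)) ->
  bmeas f -> \int[m']_y f y = \int[m]_t f (phi t).
Proof.
move=> m1 mphi m'E bf.
pose phi' : {mfun T >-> T'} := HB.pack phi (isMeasurableFun.Build _ _ _ _ phi mphi).
have fphi : m.-integrable setT ((EFin \o f) \o phi').
  exact: (bmeas_integrable m1 (bmeas_comp mphi bf)).
have mf : measurable_fun setT (EFin \o f) by apply/measurable_EFinP; case: bf.
congr fine; rewrite (eq_measure_integral (pushforward m phi')); last first.
  by move=> A mA _; exact: m'E.
by rewrite (integral_pushforward mphi mf fphi)//.
Qed.

(** * The mean TD operator *)

Section dot_products.
Context (R : realType).

Lemma dotp_col_mx m n (a c : 'cV[R]_m) (b e : 'cV[R]_n) :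
  dotp (col_mx a b) (col_mx c e) = dotp a c + dotp b e.
Proof.
rewrite /dotp big_split_ord /=; congr (_ + _); apply: eq_bigr => i _.
  by rewrite !col_mxEu.
by rewrite !col_mxEd.
Qed.

Lemma dotpE n (u v : 'cV[R]_n) : dotp u v = (u^T *m v) 0 0.
Proof. by rewrite mxE; apply: eq_bigr => i _; rewrite mxE. Qed.

Lemma sqn_eq0 n (v : 'cV[R]_n) : sqn v = 0 -> v = 0.
Proof.
move=> v0; apply/colP => i; rewrite mxE; apply/eqP; rewrite -sqrf_eq0.
by rewrite eq_le sqr_ge0 andbT -v0 le_sqn.
Qed.

Lemma mulmx_dotp m n (u : 'cV[R]_m) (v w : 'cV[R]_n) :
  (u *m v^T) *m w = dotp v w *: u.
Proof.
rewrite -mulmxA; apply/colP => i; rewrite !mxE big_ord1 mulrC dotpE.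
by congr (_ * _).
Qed.

Lemma col_mulmx m n k (A : 'M[R]_(m, n)) (B : 'M[R]_(n, k)) j :
  col j (A *m B) = A *m col j B.
Proof. by rewrite !colE mulmxA. Qed.

Lemma norm_le_enorm m n (v : 'M[R]_(m, n)) i j : `|v i j| <= enorm v.
Proof.
rewrite /enorm -sqrtr_sqr ler_wsqrtr// (bigD1 i)//= (bigD1 j)//= -addrA lerDl.
by rewrite addr_ge0//; repeat (apply: sumr_ge0 => ? _); rewrite sqr_ge0.
Qed.

End dot_products.

Section td_stationary.
Context (R : realType) (dX : measure_display) (X : measurableType dX) (d : nat).
Variables (p : R.-pker X ~> X) (mu : probability X R) (gamma : R).
Variables (r : X -> R) (x : X -> 'cV[R]_d) (eta : probability (X * X)%type R).
Hypotheses (gamma0 : 0 <= gamma) (gamma1 : gamma < 1).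
Hypotheses (br : bmeas r) (bx : bmx x).
Hypothesis etaE : pair_law p mu eta.
Hypothesis mu_stationary :
  forall Z, measurable Z -> mu Z = (\int[mu]_s p s Z)%E.

Let mu1 : mu setT = 1%E. Proof. exact: probability_setT. Qed.
Let eta1 : eta setT = 1%E. Proof. exact: probability_setT. Qed.

Let eta_rect A B : measurable A -> measurable B ->
  eta (A `*` B) = (\int[mu]_(s in A) p s B)%E.
Proof.
move=> mA mB; rewrite etaE; last exact: measurableX.
rewrite [RHS]integral_mkcond; apply: eq_integral => s _.
rewrite patchE; case: ifPn => sA; first by rewrite in_xsectionX.
by rewrite notin_xsectionX// measure0.
Qed.

Let eta_fst B : measurable B -> mu B = eta (fst @^-1` B).
Proof.
move=> mB; rewrite -setXT eta_rect//.
under eq_integral do rewrite prob_kernel.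
by rewrite integral_cst// mul1e.
Qed.

(** The second marginal of [eta] is [mu] moved by one step of [p]; this is where stationarity
    enters. *)
Let eta_snd B : measurable B -> mu B = eta (snd @^-1` B).
Proof. by move=> mB; rewrite -setTX eta_rect// -mu_stationary. Qed.

Lemma bintegral_fst (f : X -> R) : bmeas f -> \int[eta]_y f y.1 = \int[mu]_s f s.
Proof. by move=> bf; rewrite -(bintegral_transfer eta1 measurable_fst eta_fst bf). Qed.

Lemma bintegral_snd (f : X -> R) : bmeas f -> \int[eta]_y f y.2 = \int[mu]_s f s.
Proof. by move=> bf; rewrite -(bintegral_transfer eta1 measurable_snd eta_snd bf). Qed.

(** Under [eta] the second coordinate has conditional law [p] given the first, so [freezing] applies
    to the two projections. *)
Lemma bintegral_pair (F : X * X -> R) : bmeas F ->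
  \int[eta]_y F y = \int[mu]_s \int[p s]_b F (s, b).
Proof.
move=> bF; have bI := bmeas_kernel_integral p bF.
rewrite -(bintegral_fst bI) -(@freezing _ _ _ X X p _ _ eta fst snd) //.
  by apply: eq_Rintegral => -[].
move=> A B mA mB; rewrite [X in eta X](_ : _ = A `*` B)// eta_rect//.
rewrite (eq_measure_integral (pushforward eta fst)); last by move=> Z mZ _; exact: eta_fst.
rewrite ge0_integral_pushforward//.
exact: measurable_funTS (measurable_kernel p _ mB).
Qed.

Local Notation A := (td_A p mu gamma x).
Local Notation b := (td_b mu r x).
Local Notation H := (td_H gamma r x).

Definition td_rate (y : X * X) : 'M[R]_d := x y.1 *m (gamma *: x y.2 - x y.1)^T.

(** The uncentred second-moment matrix of the features; up to the added coordinate it is the matrix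
    [L] of the abstract iteration. *)
Definition feature_cov : 'M[R]_d := mx_integral mu setT (fun s => x s *m (x s)^T).

Lemma td_HE w y : H w y = td_rate y *m w + r y.1 *: x y.1.
Proof.
rewrite /td_H /td_rate mulmx_dotp -scalerDl; congr (_ *: _).
by rewrite dotpBl dotpZl !(dotpC w); ring.
Qed.

Let bx1 : bmx (fun y : X * X => x y.1).
Proof. by move=> i j; exact: (bmeas_comp measurable_fst (bx i j)). Qed.

Let bx2 : bmx (fun y : X * X => x y.2).
Proof. by move=> i j; exact: (bmeas_comp measurable_snd (bx i j)). Qed.

Let br1 : bmeas (fun y : X * X => r y.1).
Proof. exact: bmeas_comp measurable_fst br. Qed.

Lemma bmx_td_rate : bmx td_rate.
Proof.
apply: bmxM => //; apply: bmx_tr.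
by apply: bmxB => //; exact: bmxZ.
Qed.

Lemma bmx_td_H w : bmx (H w).
Proof.
rewrite (_ : H w = fun y => td_rate y *m w + r y.1 *: x y.1); last first.
  by apply/funext => y; rewrite td_HE.
apply: bmxD; first by apply: bmxM; [exact: bmx_td_rate|exact: bmx_cst].
move=> i j; have := bmeasM br1 (bx1 i j).
by congr bmeas; apply/funext => y; rewrite mxE.
Qed.

Lemma td_A_pair i j : A i j = \int[eta]_y td_rate y i j.
Proof.
rewrite (bintegral_pair (bmx_td_rate i j)) mxE; apply: eq_Rintegral => s _.
rewrite mxE big_ord1 !mxE.
have p1 : p s setT = 1%E by exact: prob_kernel.
have bxj : bmeas (fun t => x t j 0) := bx j 0.
have bg := bmeasM (bmeas_cst X gamma) bxj.
have bc := bmeas_cst X (x s j 0).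
rewrite -bintegralZ// -[X in _ * (_ - X)](bintegral_cst p1) -bintegralB//.
rewrite -bintegralZ//; last exact: bmeasB.
by apply: eq_Rintegral => t _; rewrite /td_rate mxE big_ord1 !mxE.
Qed.

Lemma td_mean w i : \int[eta]_y H w y i 0 = (A *m w + b) i 0.
Proof.
have b1 : bmeas (fun y => (td_rate y *m w) i 0).
  by apply: bmxM; [exact: bmx_td_rate|exact: bmx_cst].
have b2 : bmeas (fun y : X * X => r y.1 * x y.1 i 0) := bmeasM br1 (bx1 i 0).
transitivity (\int[eta]_y ((td_rate y *m w) i 0 + r y.1 * x y.1 i 0)).
  by apply: eq_Rintegral => y _; rewrite td_HE mxE [X in _ + X]mxE.
rewrite bintegralD// [RHS]mxE; congr (_ + _); last first.
  rewrite mxE (bintegral_fst (f := fun s => r s * x s i 0)); last exact: bmeasM.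
  by apply: eq_Rintegral => s _; rewrite mxE.
rewrite mxE; transitivity (\int[eta]_y \sum_j w j 0 * td_rate y i j).
  by apply: eq_Rintegral => y _; rewrite mxE; apply: eq_bigr => j _; rewrite mulrC.
rewrite bintegral_sum//; last first.
  by move=> j; exact: bmeasM (bmeas_cst _ _) (bmx_td_rate i j).
apply: eq_bigr => j _; rewrite bintegralZ//; last exact: bmx_td_rate.
by rewrite -td_A_pair mulrC.
Qed.

Let f e s := dotp (x s) e.
(** The squared L2(mu) norm of the value function with weights [e], through which [td_A] and
    [feature_cov] are compared. *)
Let Q e := \int[mu]_s (f e s ^+ 2).

Let bf e : bmeas (f e).
Proof. by apply: bmeas_dotp => //; exact: bmx_cst. Qed.

Let bf1 e : bmeas (fun y : X * X => f e y.1).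
Proof. exact: bmeas_comp measurable_fst (bf e). Qed.

Let bf2 e : bmeas (fun y : X * X => f e y.2).
Proof. exact: bmeas_comp measurable_snd (bf e). Qed.

Let td_A_mul e i :
  (A *m e) i 0 = \int[eta]_y (x y.1 i 0 * (gamma * f e y.2 - f e y.1)).
Proof.
rewrite mxE; transitivity (\int[eta]_y \sum_j e j 0 * td_rate y i j).
  rewrite bintegral_sum//; last first.
    by move=> j; exact: bmeasM (bmeas_cst _ _) (bmx_td_rate i j).
  apply: eq_bigr => j _; rewrite bintegralZ//; last exact: bmx_td_rate.
  by rewrite -td_A_pair mulrC.
apply: eq_Rintegral => y _.
have -> : \sum_j e j 0 * td_rate y i j = (td_rate y *m e) i 0.
  by rewrite mxE; apply: eq_bigr => j _; rewrite mulrC.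
by rewrite /td_rate mulmx_dotp mxE mulrC dotpBl dotpZl.
Qed.

Let cov_mul e i : (feature_cov *m e) i 0 = \int[mu]_s (x s i 0 * f e s).
Proof.
rewrite mxE; transitivity (\int[mu]_s \sum_j e j 0 * (x s i 0 * x s j 0)).
  rewrite bintegral_sum//; last first.
    by move=> j; exact: bmeasM (bmeas_cst _ _) (bmeasM (bx i 0) (bx j 0)).
  apply: eq_bigr => j _; rewrite bintegralZ//; last exact: bmeasM.
  rewrite mulrC mxE; congr (_ * _); apply: eq_Rintegral => s _.
  by rewrite mxE big_ord1 mxE.
apply: eq_Rintegral => s _; rewrite /f /dotp mulr_sumr.
by apply: eq_bigr => j _; ring.
Qed.

Lemma feature_cov_form e : dotp e (feature_cov *m e) = Q e.
Proof.
rewrite /dotp; under eq_bigr do rewrite cov_mul.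
have b1 i : bmeas (fun s => x s i 0 * f e s) by exact: bmeasM.
under eq_bigr do rewrite -bintegralZ//.
rewrite -bintegral_sum//; last by move=> i; exact: bmeasM (bmeas_cst _ _) (b1 i).
apply: eq_Rintegral => s _; rewrite expr2 {2}/f /dotp mulr_suml.
by apply: eq_bigr => i _; ring.
Qed.

Let sqr_fst e : \int[eta]_y (f e y.1 ^+ 2) = Q e.
Proof. by rewrite (bintegral_fst (bmeasX 2 (bf e))). Qed.

Let sqr_snd e : \int[eta]_y (f e y.2 ^+ 2) = Q e.
Proof. by rewrite (bintegral_snd (bmeasX 2 (bf e))). Qed.

(** With s' the successor of s, f(s)(gamma f(s') - f(s)) falls short of gamma/2 f(s')^2 + (gamma/2 -
    1) f(s)^2 by exactly gamma/2 (f(s) - f(s'))^2. Both marginals of [eta] being [mu], the bound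
    integrates to -(1 - gamma) Q. *)
Lemma td_A_dissipative e : dotp e (A *m e) <= - (1 - gamma) * Q e.
Proof.
have bg : bmeas (fun y : X * X => gamma * f e y.2 - f e y.1).
  exact: bmeasB (bmeasM (bmeas_cst _ _) (bf2 e)) (bf1 e).
have b1 i : bmeas (fun y => x y.1 i 0 * (gamma * f e y.2 - f e y.1)).
  exact: bmeasM (bx1 i 0) bg.
rewrite /dotp; under eq_bigr do rewrite td_A_mul -bintegralZ//.
rewrite -bintegral_sum//; last by move=> i; exact: bmeasM (bmeas_cst _ _) (b1 i).
have q1 := bmeasX 2 (bf1 e); have q2 := bmeasX 2 (bf2 e).
have c1 := bmeasM (bmeas_cst (X * X)%type (gamma / 2)) q2.
have c2 := bmeasM (bmeas_cst (X * X)%type (gamma / 2 - 1)) q1.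
have -> : - (1 - gamma) * Q e =
    \int[eta]_y (gamma / 2 * f e y.2 ^+ 2 + (gamma / 2 - 1) * f e y.1 ^+ 2).
  by rewrite bintegralD// !bintegralZ// sqr_fst sqr_snd; field.
apply: ler_bintegral => //; last 1 first.
- move=> y; rewrite (_ : \sum_i _ = f e y.1 * (gamma * f e y.2 - f e y.1)).
    have := mulr_ge0 gamma0 (sqr_ge0 (f e y.1 - f e y.2)); lra.
  rewrite {3}/f /dotp mulr_suml; apply: eq_bigr => i _; ring.
- by apply: bmeas_sum => i; exact: bmeasM (bmeas_cst _ _) (b1 i).
- exact: bmeasD.
Qed.

Lemma sqn_means_le : exists2 K, 0 <= K & forall e,
  sqn (A *m e) <= K * Q e /\ sqn (feature_cov *m e) <= K * Q e.
Proof.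
have [K K0 xK] := bmx_bound bx.
(* [d] coordinates, features bounded by [K], and (gamma f(s') - f(s))^2 <= 2 (f(s')^2 + f(s)^2),
   whose mean is at most 4 Q. *)
exists (d%:R * (4 * K ^+ 2)) => [|e]; first by rewrite !mulr_ge0 ?sqr_ge0.
have Q0 : 0 <= Q e by apply: Rintegral_ge0 => s _; exact: sqr_ge0.
have xK2 s i : x s i 0 ^+ 2 <= K ^+ 2.
  by rewrite -real_normK ?num_real// ler_sqr ?nnegrE.
have dc (a : R) : d%:R * a = \sum_(i < d) a.
  by rewrite sumr_const card_ord mulr_natl.
rewrite -(mulrA d%:R) dc.
split; apply: ler_sum => i _; rewrite -expr2.
  have bg : bmeas (fun y : X * X => gamma * f e y.2 - f e y.1).
    exact: bmeasB (bmeasM (bmeas_cst _ _) (bf2 e)) (bf1 e).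
  rewrite td_A_mul; apply: le_trans (sqr_bintegral _ _) _ => //.
    exact: bmeasM (bx1 i 0) bg.
  have q1 := bmeasX 2 (bf1 e); have q2 := bmeasX 2 (bf2 e).
  rewrite [leRHS](_ : _ = \int[eta]_y (2 * K ^+ 2 * (f e y.2 ^+ 2 + f e y.1 ^+ 2))).
    apply: ler_bintegral => //.
    - by apply: bmeasX; exact: bmeasM (bx1 i 0) bg.
    - exact: bmeasM (bmeas_cst _ _) (bmeasD q2 q1).
    move=> y; rewrite exprMn.
    apply: (@le_trans _ _ (K ^+ 2 * (gamma * f e y.2 - f e y.1) ^+ 2)).
      by rewrite ler_wpM2r ?sqr_ge0.
    rewrite -[leRHS]mulrA [leRHS]mulrCA ler_wpM2l ?sqr_ge0//.
    have g2 : gamma ^+ 2 <= 1 by rewrite expr_le1// ltW.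
    have := ler_wpM2r (sqr_ge0 (f e y.2)) g2.
    have := sqr_ge0 (gamma * f e y.2 + f e y.1); lra.
  by rewrite bintegralZ ?bintegralD// ?sqr_fst ?sqr_snd; [ring|exact: bmeasD].
rewrite cov_mul; apply: le_trans (sqr_bintegral _ _) _ => //.
  exact: bmeasM (bx i 0) (bf e).
have q := bmeasX 2 (bf e).
apply: (@le_trans _ _ (\int[mu]_s (K ^+ 2 * f e s ^+ 2))).
  apply: ler_bintegral => //.
  - by apply: bmeasX; exact: bmeasM (bx i 0) (bf e).
  - exact: bmeasM (bmeas_cst _ _) q.
  by move=> s; rewrite exprMn ler_wpM2r ?sqr_ge0.
rewrite bintegralZ// -/(Q e); have := mulr_ge0 (sqr_ge0 K) Q0; lra.
Qed.

(** A vector e killed by the second-moment matrix has Q e = 0, hence A e = 0. Testing this on the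
    columns of the cokernel matrix, which span that kernel, gives the inclusion of row spaces. *)
Lemma td_A_factor : exists G, A = G *m feature_cov.
Proof.
apply/submxP; rewrite submxE; apply/eqP/matrixP => i j.
have : feature_cov *m col j (cokermx feature_cov) = 0.
  by rewrite -col_mulmx mulmx_coker; apply/colP => k; rewrite !mxE.
set e := col j _ => cov0.
have Q0 : Q e = 0.
  by rewrite -feature_cov_form cov0 /dotp big1// => k _; rewrite [X in _ * X]mxE mulr0.
have [K _ /(_ e)[A0 _]] := sqn_means_le; rewrite Q0 mulr0 in A0.
have /sqn_eq0 /colP/(_ i) : sqn (A *m e) = 0 by apply: le_anti; rewrite A0 sqn_ge0.
by rewrite /e -col_mulmx !mxE.
Qed.

Lemma td_A_dissipative_cov : exists2 c, 0 < c &
  forall e, dotp e (A *m e) <= - c * sqn (feature_cov *m e).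
Proof.
have [K K0 QK] := sqn_means_le.
(* [K] may vanish, so the division is by [K + 1]. *)
have K1 : 0 < K + 1 by rewrite ltr_wpDl.
exists ((1 - gamma) / (K + 1)) => [|e]; first by rewrite divr_gt0// subr_gt0.
have [_ h] := QK e; apply: le_trans (td_A_dissipative e) _.
rewrite !mulNr lerN2 mulrAC ler_pdivrMr// -mulrA.
apply: ler_wpM2l; first by rewrite subr_ge0 ltW.
have Q0 : 0 <= Q e by apply: Rintegral_ge0 => s _; exact: sqr_ge0.
by apply: (le_trans h); lra.
Qed.

(** The states at which a prediction depends on the weights only through their image under
    [feature_cov]. *)
Definition feature_support : set X := [set s | ((x s)^T <= feature_cov)%MS].

(** Membership means that C^T x(s) = 0 for the cokernel matrix [C]. The mean of |C^T x|^2 is the sum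
    of c^T Sigma c over the columns c of [C], with Sigma the second-moment matrix, and Sigma c =
    0. *)
Lemma feature_support_full :
  measurable feature_support /\ mu feature_support = 1%E.
Proof.
pose C := cokermx feature_cov.
have bg : bmeas (fun s => sqn (C^T *m x s)).
  by apply: bmeas_dotp; apply: bmxM => //; exact: bmx_cst.
have suppE : feature_support = [set s | sqn (C^T *m x s) = 0].
  apply/seteqP; split => s /=.
    rewrite /feature_support/= submxE => /eqP h.
    rewrite (_ : C^T *m x s = 0) ?/sqn ?/dotp ?big1// => [i _|].
      by rewrite !mxE mul0r.
    by apply: trmx_inj; rewrite trmx_mul trmxK h trmx0.
  move/sqn_eq0 => h; rewrite /feature_support/= submxE; apply/eqP.
  by apply: trmx_inj; rewrite trmx_mul trmxK trmx0.
have msupp : measurable feature_support.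
  rewrite suppE -[X in measurable X]setTI.
  have [mg _] := bg; rewrite (_ : [set _ | _] = (fun s => sqn (C^T *m x s)) @^-1` [set 0])//.
  by apply: mg => //; exact: measurable_set1.
split => //.
have g0 s : 0 <= sqn (C^T *m x s) by exact: sqn_ge0.
have bfj j : bmeas (fun s => f (col j C) s ^+ 2) by exact: bmeasX.
have I0 : \int[mu]_s sqn (C^T *m x s) = 0.
  transitivity (\int[mu]_s \sum_j f (col j C) s ^+ 2).
    apply: eq_Rintegral => s _; apply: eq_bigr => j _; rewrite expr2.
    suff -> : (C^T *m x s) j 0 = f (col j C) s by [].
    by rewrite mxE; apply: eq_bigr => k _; rewrite !mxE mulrC.
  rewrite bintegral_sum// big1// => j _; rewrite -/(Q _) -feature_cov_form -col_mulmx.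
  rewrite mulmx_coker /dotp big1// => k _; rewrite !mxE mulr0//.
have [Z [mZ Z0 sZ]] := bintegral0_ae mu1 bg g0 I0.
have mC : mu (~` feature_support) = 0.
  apply/eqP; rewrite eq_le measure_ge0 andbT -Z0.
  apply: le_measure; rewrite ?inE//; first exact: measurableC.
  by rewrite suppE.
by rewrite -[feature_support]setCK probability_setC ?mC ?sube0//; exact: measurableC.
Qed.

End td_stationary.

(** * Almost sure convergence of linear TD *)

Section blocks.
Context (R : realType) (d : nat).
Implicit Types (A B : 'M[R]_d) (u v : 'cV[R]_d).

(* the affine map w |-> A w + v, acting on col_mx w 1 with value in col_mx _ 0 *)
Definition affine_mx A v : 'M[R]_(d + 1) := block_mx A v 0 0.

Lemma affine_mxE A v w c :
  affine_mx A v *m col_mx w c%:M = col_mx (A *m w + c *: v) 0.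
Proof.
by rewrite /affine_mx mul_block_col !mul0mx addr0 mul_mx_scalar.
Qed.

Lemma affine_mxB A B u v : affine_mx A u - affine_mx B v = affine_mx (A - B) (u - v).
Proof. by rewrite /affine_mx opp_block_mx add_block_mx !subr0. Qed.

Lemma affine_mxD A B u v : affine_mx A u + affine_mx B v = affine_mx (A + B) (u + v).
Proof. by rewrite /affine_mx add_block_mx !addr0. Qed.

Lemma col_mx_scalar (z : 'cV[R]_(d + 1)) : z = col_mx (usubmx z) (dsubmx z 0 0)%:M.
Proof. by rewrite -mx11_scalar vsubmxK. Qed.

Lemma bmx_affine dT (T : measurableType dT) (A : T -> 'M[R]_d) (v : T -> 'cV[R]_d) :
  bmx A -> bmx v -> bmx (fun t => affine_mx (A t) (v t)).
Proof.
move=> bA bv i j; rewrite -(fintype.splitK i) -(fintype.splitK j).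
case: (fintype.split i) => k; case: (fintype.split j) => l /=.
- by have := bA k l; congr bmeas; apply/funext => t; rewrite block_mxEul.
- by have := bv k l; congr bmeas; apply/funext => t; rewrite block_mxEur.
- have := bmeas_cst T (0 : R).
  by congr bmeas; apply/funext => t; rewrite block_mxEdl mxE.
- have := bmeas_cst T (0 : R).
  by congr bmeas; apply/funext => t; rewrite block_mxEdr mxE.
Qed.

Lemma kernel_mean_affine dX (X : measurableType dX) (p : R.-pker X ~> X)
    (A : X * X -> 'M[R]_d) (v : X * X -> 'cV[R]_d) s :
  kernel_mean p (fun y => affine_mx (A y) (v y)) s =
  affine_mx (kernel_mean p A s) (kernel_mean p v s).
Proof.
have p1 : p s setT = 1%E by exact: prob_kernel.
apply/matrixP => i j; rewrite mxE -(fintype.splitK i) -(fintype.splitK j).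
case: (fintype.split i) => k; case: (fintype.split j) => l /=.
- by rewrite block_mxEul mxE; apply: eq_Rintegral => b _; rewrite block_mxEul.
- by rewrite block_mxEur mxE; apply: eq_Rintegral => b _; rewrite block_mxEur.
- rewrite block_mxEdl mxE -[RHS](bintegral_cst p1).
  by apply: eq_Rintegral => b _; rewrite block_mxEdl mxE.
- rewrite block_mxEdr mxE -[RHS](bintegral_cst p1).
  by apply: eq_Rintegral => b _; rewrite block_mxEdr mxE.
Qed.

End blocks.

Section td_convergence.
Context (R : realType) (dO dX : measure_display).
Context (Omega : measurableType dO) (X : measurableType dX) (d : nat).
Variables (P : probability Omega R) (p : R.-pker X ~> X).
Variable S_ : nat -> {RV P >-> X}.
Variables (mu : probability X R) (gamma : R) (r : X -> R) (x : X -> 'cV[R]_d).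
Variables (eta : probability (X * X)%type R) (alpha : nat -> R).
Hypothesis chain : markov_chain p S_.
Hypotheses (gamma0 : 0 <= gamma) (gamma1 : gamma < 1).
Hypothesis bx : bmx x.
Hypothesis etaE : pair_law p mu eta.
Hypothesis mu_stationary :
  forall Z, measurable Z -> mu Z = (\int[mu]_s p s Z)%E.
Hypotheses (alpha0 : forall t, 0 < alpha t) (alpha_dec : nonincreasing_seq alpha).
Hypothesis alpha_oo : series alpha @ \oo --> +oo.
Hypothesis alpha2 : cvgn (series (fun t => alpha t ^+ 2)).
Variables (Y : set (X * X)) (N : X * X -> 'M[R]_d) (nu : X * X -> 'cV[R]_d).
Variable wstar : 'cV[R]_d.
Hypotheses (bN : bmx N) (bnu : bmx nu).
Hypothesis poissonN : forall y, Y y ->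
  N y - kernel_mean p N y.2 = td_rate gamma x y - td_A p mu gamma x.
Hypothesis poisson_nu : forall y, Y y ->
  nu y - kernel_mean p nu y.2 = td_H gamma r x wstar y.
Hypothesis chainY : {ae P, forall om, forall t, Y (S_ t om, S_ t.+1 om)}.

Lemma td_iter_cvg w0 s : feature_support mu x s ->
  {ae P, forall om,
    (fun t => dotp (x s) (td_iter gamma r x alpha w0 (fun n => S_ n om) t)) @ \oo
      --> dotp (x s) wstar}.
Proof.
move=> /submxP[D xD].
set A := td_A p mu gamma x.
set Sigma := feature_cov mu x in xD.
have [G AG] := td_A_factor gamma0 gamma1 bx etaE mu_stationary.
have [c c0 Ac] := td_A_dissipative_cov gamma0 gamma1 bx etaE mu_stationary.
have bNn := bmx_affine bN bnu.
have AG' : affine_mx A 0 = affine_mx G 0 *m affine_mx Sigma 0.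
  by rewrite /affine_mx mulmx_block !mul0mx !mulmx0 !addr0 -AG.
have Ac' v : dotp v (affine_mx A 0 *m v) <= - c * sqn (affine_mx Sigma 0 *m v).
  rewrite (col_mx_scalar v) !affine_mxE !scaler0 !addr0 /sqn !dotp_col_mx.
  have dotp0 k (u : 'cV[R]_k) : dotp u 0 = 0.
    by rewrite /dotp big1// => i _; rewrite mxE mulr0.
  by rewrite !dotp0 !addr0; exact: Ac.
have := lin_iter_cvg0 chain bNn c0 AG' Ac' alpha0 alpha_dec alpha_oo alpha2
  (col_mx (w0 - wstar) 1%:M).
apply: filterS2 chainY => om Yom cvg_om.
set w := td_iter _ _ _ _ _ _.
(* At Y_t the Poisson identities turn the random block matrix into the affine map v -> B v +
   H(wstar, Y_t), with B = [td_rate]; at v = w - wstar its value is H(w, Y_t), because H is affine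
   in w. *)
have iterE t : lin_iter alpha (fun t => affine_mx A 0 +
      affine_mx (N (S_ t om, S_ t.+1 om)) (nu (S_ t om, S_ t.+1 om)) -
      kernel_mean p (fun y => affine_mx (N y) (nu y)) (S_ t.+1 om))
    (col_mx (w0 - wstar) 1%:M) t = col_mx (w t - wstar) 1%:M.
  elim: t => [//|t ih] /=; rewrite ih kernel_mean_affine affine_mxD affine_mxB.
  have /= := poissonN (Yom t); rewrite -/A => pN; have /= pn := poisson_nu (Yom t).
  rewrite add0r pn -addrA pN addrC subrK affine_mxE scale1r.
  rewrite scale_col_mx scaler0 add_col_mx addr0; congr col_mx.
  rewrite [RHS]addrAC; congr (_ + _ *: _).
  have -> : td_rate gamma x (S_ t om, S_ t.+1 om) *m (w t - wstar) +
      td_H gamma r x wstar (S_ t om, S_ t.+1 om) =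
      td_H gamma r x (w t) (S_ t om, S_ t.+1 om).
    by rewrite !td_HE addrA -mulmxDr subrK.
  by rewrite /td_H /= !(dotpC (w t)).
(* As x(s)^T = D Sigma, the prediction error is a fixed combination of the coordinates of Sigma (w -
   wstar), each of which tends to 0. *)
have xE t : dotp (x s) (w t) =
    \sum_i D 0 i * (affine_mx Sigma 0 *m col_mx (w t - wstar) 1%:M) (lshift 1 i) 0 +
    dotp (x s) wstar.
  rewrite -{1}(subrK wstar (w t)) dotpDr; congr (_ + _).
  rewrite dotpE xD -mulmxA mxE; apply: eq_bigr => i _; congr (_ * _).
  by rewrite affine_mxE scaler0 addr0 col_mxEu.
rewrite (_ : (fun t => _) = fun t => \sum_i D 0 i * (affine_mx Sigma 0 *m
    col_mx (w t - wstar) 1%:M) (lshift 1 i) 0 + dotp (x s) wstar); last exact/funext.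
rewrite -[X in _ --> X]add0r; apply: cvgD; last exact: cvg_cst.
rewrite [X in _ --> X](_ : _ = \sum_i D 0 i * 0); last first.
  by rewrite big1// => i _; rewrite mulr0.
apply: cvg_big; [exact: add_continuous|move=> i _; apply: cvgMr].
have := cvg_om (lshift 1 i).
by under eq_fun do rewrite iterE.
Qed.

End td_convergence.

(** * Bounded Poisson solutions on a compact state space, and the theorem *)

Section bounded_borel.
Context (R : realType).

Lemma measurable_coord dT (T : measurableType dT) d (D : set T)
    (f : T -> borel 'cV[R]_d) i :
  measurable_fun D f -> measurable_fun D (fun t => (f t : 'cV[R]_d) i 0).
Proof.
move=> mf; apply: (@measurableT_comp _ _ _ _ _ _ (fun v : borel 'cV[R]_d => (v : 'cV[R]_d) i 0)) mf.
apply: (measurability _ (RGenOpens.measurableE R)) => _ [_ [a [b ->]] <-].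
rewrite setTI; apply: sub_sigma_algebra => /=.
by apply: open_comp (interval_open _ _) => // v _; exact: coord_continuous.
Qed.

(** Turns the linear growth in y of the Poisson solutions into a uniform bound. *)
Lemma compact_enorm_row_mx_bounded K (S : set 'rV[R]_K) : compact S ->
  exists2 M, 0 <= M & forall a b, S a -> S b -> enorm (row_mx a b) <= M.
Proof.
move=> /compact_bounded [B [_ SB]].
have entry (a : 'rV[R]_K) i j : S a -> `|a i j| <= `|B| + 1.
  move=> Sa; apply: le_trans (SB (`|B| + 1) _ a Sa); last first.
    by rewrite (le_lt_trans (ler_norm B))// ltrDl.
  rewrite [leRHS]mx_normrE.
  exact: (le_bigmax _ (fun ij : 'I_1 * 'I_K => `|a ij.1 ij.2|) (i, j)).
exists (Num.sqrt (\sum_(i < 1) \sum_(j < K + K) (`|B| + 1) ^+ 2)).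
  exact: sqrtr_ge0.
move=> a b Sa Sb; apply: ler_wsqrtr; apply: ler_sum => i _; apply: ler_sum => j _.
rewrite -real_normK ?num_real// ler_sqr ?nnegrE ?addr_ge0//.
rewrite -(fintype.splitK j); case: (fintype.split j) => k /=.
  by rewrite row_mxEl entry.
by rewrite row_mxEr entry.
Qed.

Lemma bintegral_full dT (T : measurableType dT) (P : probability T R) (Y : set T)
    (f : T -> R) : measurable Y -> P Y = 1%E -> bmeas f ->
  \int[P]_(t in Y) f t = \int[P]_t f t.
Proof.
move=> mY PY [mf _]; rewrite Rintegral_mkcond; congr fine.
apply: ae_eq_integral => //.
- apply/measurable_EFinP; apply/(measurable_restrictT _ mY).
  exact: measurable_funTS.
- exact/measurable_EFinP.
have PC : P (~` Y) = 0%E by rewrite probability_setC// PY subee.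
exists (~` Y); split => //; first exact: measurableC.
by move=> t /= H Yt; apply: H => _; rewrite patchE mem_set.
Qed.

End bounded_borel.

Theorem theorem18 (R : realType) (K d : nat)
  (S : set 'rV[R]_K) (S0 : S !=set0)
  (p : R.-pker borel (state S0) ~> borel (state S0))
  (dO : measure_display) (Omega : measurableType dO) (P : probability Omega R)
  (S_ : nat -> {RV P >-> borel (state S0)})
  (r : borel (state S0) -> R) (gamma : R)
  (x : borel (state S0) -> 'cV[R]_d)
  (mu : probability (borel (state S0)) R)
  (Y : set (borel (state S0) * borel (state S0)))
  (eta : probability (borel (state S0) * borel (state S0))%type R)
  (alpha : nat -> R) :
  markov_chain p S_ ->
  measurable_fun [set: borel (state S0)] r ->
  0 <= gamma < 1 ->
  measurable_fun [set: borel (state S0)] (x : _ -> borel 'cV[R]_d) ->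
  (* the pair chain evolves in Y, with unique stationary distribution eta *)
  measurable Y ->
  (forall y, Y y -> pair_kernel p y Y = 1%E) ->
  {ae P, forall om, forall t, Y (S_ t om, S_ t.+1 om)} ->
  pair_law p mu eta ->
  unique_stationary_dist Y (pair_kernel p) eta ->
  (* (1) *)
  step_sizes alpha ->
  (* (2) *)
  unique_stationary_dist setT p mu ->
  (forall U : set (state S0), open U -> U !=set0 -> (0 < mu U)%E) ->
  (* (3) *)
  has_ubound (range (fun s => enorm (x s))) ->
  has_ubound (range (fun s => `|r s|)) ->
  (* (4) *)
  (forall (n : nat) (f : borel (state S0) -> 'cV[R]_n),
    measurable_fun [set: borel (state S0)] (f : _ -> borel 'cV[R]_n) ->
    {ae mu, forall s, f s = 0} -> {ae mu, forall s, Ppi p f s = 0}) ->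
  (* (5) *)
  poisson_equation p Y (td_H gamma r x) (td_h gamma r x Y eta) ->
  (* (6) *)
  iterated_log_bound P (fun t om => (S_ t om, S_ t.+1 om))
    (td_H gamma r x) (td_h gamma r x Y eta) ->
  (* (7) *)
  compact S ->
  forall wstar : 'cV[R]_d, td_fixed_points p mu gamma r x wstar ->
  forall w0 : 'cV[R]_d,
  exists Splus : set (borel (state S0)),
    [/\ measurable Splus, mu Splus = 1%E &
        forall s, Splus s ->
          {ae P, forall om,
            (fun t => dotp (x s)
               (td_iter gamma r x alpha w0 (fun n => S_ n om) t)) @ \oo
              --> dotp (x s) wstar}].
Proof.
move=> chain mr /andP[gamma0 gamma1] mx mY _ chainY etaE [[etaY _] _].
move=> [alpha0 alpha_dec alpha_oo alpha2 _] [[_ mu_st] _] _ [Kx Hx] [Kr Hr] _.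
move=> [nu [mnu nuP [C nuC]]] _ compactS wstar wstar_fix w0.
set X := borel (state S0) in p P S_ r x mu Y eta chain mr mx mY chainY etaE etaY
  mu_st Hx Hr nu mnu nuP nuC wstar_fix *.
have br : bmeas r by split => //; exists Kr => s; apply: Hr; exists s.
have bx : bmx x.
  move=> i j; rewrite (ord1 j); split; first exact: measurable_coord.
  by exists Kx => s; apply: le_trans (norm_le_enorm _ _ _) _; apply: Hx; exists s.
have mu_stationary Z : measurable Z -> mu Z = (\int[mu]_s p s Z)%E.
  by move=> mZ; exact: mu_st.
have [M M0 HM] := compact_enorm_row_mx_bounded compactS.
(* The Poisson solutions are measurable and bounded on [Y] only; extending them by zero gives
   bounded measurable functions on all pairs. *)
pose nuY w (y : X * X) : 'cV[R]_d := if y \in Y then nu w y else 0.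
have nuYE w i : (fun y => nuY w y i 0) = (fun y => nu w y i 0) \_ Y.
  by apply/funext => y; rewrite patchE /nuY; case: ifP => // _; rewrite mxE.
have bnuY w : bmx (nuY w).
  move=> i j; rewrite (ord1 j) nuYE; split.
    by apply/(measurable_restrictT _ mY); exact: measurable_coord.
  exists (`|C| * (1 + enorm w) * (1 + M)) => y.
  have enorm0 m n (v : 'M[R]_(m, n)) : 0 <= enorm v by exact: sqrtr_ge0.
  rewrite patchE; case: ifPn => [/set_mem Yy|_]; last first.
    by rewrite normr0 !mulr_ge0// addr_ge0.
  apply: le_trans (norm_le_enorm _ _ _) _; have [+ _] := nuC w w y Yy.
  move=> /le_trans; apply.
  set nY := enorm (row_mx _ _).
  apply: (@le_trans _ _ (`|C| * (1 + enorm w) * (1 + nY))).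
    apply: ler_wpM2r; first exact: addr_ge0 ler01 (enorm0 _ _ _).
    by apply: ler_wpM2r; [rewrite addr_ge0|exact: ler_norm].
  apply: ler_wpM2l; first by rewrite mulr_ge0// addr_ge0.
  by rewrite lerD2l; apply: HM; apply: set_mem; exact: valP.
(* The pair kernel at [y] is the image of [p y.2] under b -> (y.2, b), and the zero extension
   absorbs the restriction to [Y]. The mean therefore depends on [y.2] alone, which is why M is
   evaluated at S_{t+1}. *)
have PnuE w y i : mx_integral (pair_kernel p y) Y (nu w) i 0 =
    \int[p y.2]_b nuY w (y.2, b) i 0.
  rewrite mxE Rintegral_mkcond -nuYE.
  rewrite (bintegral_transfer (m := p y.2) (phi := fun b => (y.2, b)))//.
  - exact: prob_kernel.
  - by apply: measurable_fun_pair => //; exact: measurable_cst.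
  - exact: bnuY.
have hE w : td_h gamma r x Y eta w = td_A p mu gamma x *m w + td_b mu r x.
  apply/colP => i; rewrite mxE bintegral_full//; last exact: bmx_td_H.
  exact: td_mean.
have poissonE w y i : Y y -> nuY w y i 0 - \int[p y.2]_b nuY w (y.2, b) i 0 =
    (td_H gamma r x w y - (td_A p mu gamma x *m w + td_b mu r x)) i 0.
  by move=> Yy; rewrite -hE -nuP// -PnuE [RHS]mxE [X in _ = _ + X]mxE /nuY mem_set.
(* As H is affine in w, H(wstar + e_j, y) - H(wstar, y) is the j-th column of [td_rate] at y. The
   difference of the two Poisson solutions is thus the j-th column of a solution for the linear
   part. *)
pose wj j := wstar + delta_mx j 0.
pose N y := \matrix_(i, j) (nuY (wj j) y i 0 - nuY wstar y i 0).
have bN : bmx N.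
  move=> i j; have := bmeasB (bnuY (wj j) i 0) (bnuY wstar i 0).
  by congr bmeas; apply/funext => y; rewrite mxE.
have poissonN y : Y y ->
    N y - kernel_mean p N y.2 = td_rate gamma x y - td_A p mu gamma x.
  move=> Yy; apply/matrixP => i j; rewrite 4!mxE [RHS]mxE [X in _ = _ + X]mxE.
  have -> : \int[p y.2]_b N (y.2, b) i j =
      \int[p y.2]_b nuY (wj j) (y.2, b) i 0 - \int[p y.2]_b nuY wstar (y.2, b) i 0.
    rewrite -bintegralB; last 3 first.
    - exact: prob_kernel.
    - exact: (bmeas_section y.2 (bnuY (wj j) i 0)).
    - exact: (bmeas_section y.2 (bnuY wstar i 0)).
    by apply: eq_Rintegral => b _; rewrite mxE.
  have := poissonE (wj j) y i Yy; have := poissonE wstar y i Yy.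
  rewrite !td_HE /wj !mulmxDr -!colE.
  move: (td_rate gamma x y) (td_A p mu gamma x) => B A.
  move: (B *m wstar) (A *m wstar) (r y.1 *: x y.1) (td_b mu r x) => u1 u2 u3 u4.
  by rewrite !mxE; lra.
have poisson_nu y : Y y ->
    nuY wstar y - kernel_mean p (nuY wstar) y.2 = td_H gamma r x wstar y.
  move=> Yy; apply/colP => i; rewrite mxE [X in _ + X]mxE [X in _ - X]mxE poissonE//.
  by rewrite wstar_fix subr0.
have [msupp mu_supp] := feature_support_full mu bx.
exists (feature_support mu x); split => // s supp_s.
exact: (td_iter_cvg chain gamma0 gamma1 bx etaE mu_stationary alpha0 alpha_dec
  alpha_oo alpha2 bN (bnuY wstar) poissonN poisson_nu chainY w0 supp_s).
Qed.
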